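(* Let $K$ be an algebraically closed field that is complete with respect to a nontrivial ultrametric norm $|\cdot|$ and whose residue characteristic is a prime number $p$. Put $$q = (p-1)(2p^2-2p-1) \quad\text{and}\quad \kappa = \frac{p^{2p-2}}{p^{2p-1}-p+1}.$$ Let $(\ell_s)_{s=0}^{+\infty}$ be a strictly increasing sequence of integers satisfying $\ell_0 = 0$ and put $$t = -\frac{p}{(p-1)^2} + \frac{p^{2p-1}-p+1}{(p-1)^2 p^{2p+1}(p^{2p-2}-1)} \sum_{s=0}^{+\infty} \frac{1}{p^{q\ell_s+s}}\left(1 - \frac{\kappa}{p^{2(p-1)^3(\ell_{s+1}-\ell_s)}}\right).$$ Given $k \in \mathbb{Z}_{\ge 0}$, let $s \in \mathbb{Z}_{\ge 0}$ be uniquely determined by $\ell_s(p-1)^2 - 1 \le k < \ell_{s+1}(p-1)^2 - 1$ and put $$M_k = 2k + 2 + (2p-3)\ell_s.$$ Furthermore, put $m_0 = 2p+1$ and, for each $k \in \mathbb{Z}_{>0}$, $m_k = (p-1)M_{k-1} + 2p + 1$. Then, for every $a_0 \in \mathcal{A}$ there is a parameter $a \in \mathcal{A}$ satisfying $|a - a_0| = |a_0|^{-(M_0-1)}$ and a point $x_0 \in \mathcal{K}(P_a)$ whose itinerary for $P_a$ is $$\underbrace{0\ldots0}_{m_0}\underbrace{1\ldots1}_{M_0}\underbrace{0\ldots0}_{m_1}\underbrace{1\ldots1}_{M_1}\ldots$$ and such that the ball $\{z \in K : |z - x_0| \le |a|^t\}$ is a nontrivial wandering component of $\mathcal{K}(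P_a)$.
   Context: $\mathcal{A} = \{a \in K : |a| > 1 \text{ and } |a p^{p-1}| \le 1\}$, and for $a \in \mathcal{A}$, $P_a(z) = a z^p + (1-a) z^{p+1}$. The filled Julia set of $P_a$ is $\mathcal{K}(P_a) = \{z \in K : (P_a^n(z))_{n \ge 1} \text{ is bounded}\}$. For $z_0 \in K$ and $r \in \mathbb{R}_{>0}$, the ball $\{z \in K : |z - z_0| \le r\}$ is a component of $\mathcal{K}(P_a)$ if it is contained in $\mathcal{K}(P_a)$ and for every real $r' > r$ the disk $\{z \in K : |z - z_0| < r'\}$ is not contained in $\mathcal{K}(P_a)$. The polynomial $P_a$ maps each component of $\mathcal{K}(P_a)$ onto a component. A component $B$ of $\mathcal{K}(P_a)$ is wandering if for all distinct $i, j \in \mathbb{Z}_{\ge 0}$ the sets $P_a^i(B)$ and $P_a^j(B)$ are disjoint. A wandering component $\{z \in K : |z - z_0| \le r\}$ is called nontrivial if $\{z \in K : |z - z_0| < r\}$ is the intersection with $K$ of a nontrivial wandering Fatou component of $P_a$ in the Berkovich projective line $\mathsf{P}^1_K$. Here the Fatou set of $P_a$ is the set of points of $\mathsf{P}^1_K$ having an open neighborhood $U$ such that $\bigcup_{n\ge 0} P_a^n(U)$ omits infinitely many points of $\mathsf{P}^1_K$; Fatou components are its connected components; a Fatou component is wandering if its forward iterates are pairwise disjoint, and a wandering one is nontrivial if it contains no point of $\mathsf{P}^1_K$ whose forward orbit is asymptotic to a periodic orbit in $\mathsf{P}^1_K$. Put $B(0) = \{z \in K : |z| < 1\}$ and $B(1)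 = \{z \in K : |z - 1| < 1\}$. These are disjoint and their union contains $\mathcal{K}(P_a)$. The itinerary for $P_a$ of $x \in \mathcal{K}(P_a)$ is the sequence $\theta_0\theta_1\ldots$ in $\{0,1\}$ such that $P_a^i(x) \in B(\theta_i)$ for every $i \in \mathbb{Z}_{\ge 0}$. *)

(* Defs.v *)
From HB Require Import structures.
From mathcomp Require Import all_boot all_order all_algebra.
From mathcomp Require Import boolp classical_sets functions cardinality.
From mathcomp Require Import reals topology normedtype sequences exp.

Set Implicit Arguments.
Unset Strict Implicit.
Unset Printing Implicit Defensive.

Import Order.TTheory GRing.Theory Num.Theory.
Import numFieldNormedType.Exports.

Local Open Scope classical_set_scope.
Local Open Scope ring_scope.

Record ultranorm (R : realType) (K : fieldType) := Ultranorm {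
  ultranorm_fun :> K -> R;
  ultranorm_ge0 : forall x, 0 <= ultranorm_fun x;
  ultranorm_eq0 : forall x, ultranorm_fun x = 0 <-> x = 0;
  ultranormM : forall x y,
    ultranorm_fun (x * y) = ultranorm_fun x * ultranorm_fun y;
  ultranormD : forall x y,
    ultranorm_fun (x + y) <= Num.max (ultranorm_fun x) (ultranorm_fun y) }.

Section Field.
Context {R : realType} {K : fieldType} (v : ultranorm R K).

Definition nontrivial_norm : Prop := exists2 x : K, x != 0 & v x != 1.

Definition complete_norm : Prop := forall u : nat -> K,
  (forall e : R, 0 < e -> exists N, forall m n,
     (N <= m)%N -> (N <= n)%N -> v (u m - u n) < e) ->
  exists l : K, v (u n - l) @[n --> \oo] --> (0 : R).

(* The residue field is the quotient of {|x| <= 1} by its maximal ideal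
   {|x| < 1}, and [p%:R = 0] in this quotient means [v p%:R < 1]. *)
Definition residue_char (p : nat) : Prop := prime p /\ v p%:R < 1.

Definition closed_disk (z0 : K) (r : R) : set K := [set z | v (z - z0) <= r].
Definition open_disk (z0 : K) (r : R) : set K := [set z | v (z - z0) < r].

End Field.

Section Dynamics.
Context {T : Type}.

Definition wandering (f : T -> T) (B : set T) : Prop :=
  forall i j : nat, i != j -> iter i f @` B `&` iter j f @` B = set0.

End Dynamics.

Section Fatou.
Context {T : topologicalType} (f : T -> T).

Definition Fatou_set : set T := [set x | exists U : set T,
  [/\ open U, U x & infinite_set (~` \bigcup_n (iter n f @` U))]].

Definition Fatou_component (W : set T) : Prop :=
  exists2 x, Fatou_set x & W = connected_component Fatou_set x.

Definition asymptotic_to_periodic (x : T) : Prop :=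
  exists (y : T) (k : nat), [/\ (0 < k)%N, iter k f y = y &
    forall U : set T, open U -> range (fun j => iter j f y) `<=` U ->
      \forall n \near \oo, U (iter n f x)].

Definition nontrivial_wandering_Fatou_component (W : set T) : Prop :=
  [/\ Fatou_component W, wandering f W &
      forall x, W x -> ~ asymptotic_to_periodic x].

End Fatou.

Section Berkovich.
Context {R : realType} {K : fieldType} (v : ultranorm R K).

(* Points of the Berkovich affine line: multiplicative seminorms on K[z]
   extending the norm of K, with the topology of pointwise convergence. *)
Definition multiplicative_seminorms : set {ptws {poly K} -> R} :=
  [set x | [/\ forall g, 0 <= x g,
               forall c : K, x c%:P = v c,
               forall g h, x (g * h) = x g * x h &
               forall g h, x (g + h) <= x g + x h]].

Definition berkA1 : topologicalType := set_type multiplicative_seminorms.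

(* The affine line is locally compact and Hausdorff, and the projective line is
   its one-point compactification; [None] is the point at infinity. *)
Definition berkP1 : topologicalType := one_point_compactification berkA1.

Lemma berk_eval_subproof (z : K) :
  (fun g : {poly K} => v g.[z]) \in multiplicative_seminorms.
Proof.
apply/mem_set; split=> [g|c|g h|g h].
- exact: ultranorm_ge0.
- by rewrite hornerC.
- by rewrite hornerM ultranormM.
- rewrite hornerD (le_trans (ultranormD _ _ _))// ge_max.
  by rewrite lerDl lerDr !ultranorm_ge0.
Qed.

Definition berk_of (z : K) : berkP1 :=
  Some (SigSub (berk_eval_subproof z)).

Lemma berk_push_subproof (P : {poly K}) (x : berkA1) :
  (fun g : {poly K} => \val x (g \Po P)) \in multiplicative_seminorms.
Proof.
case: x => x /= /set_mem[x0 xC xM xD]; apply/mem_set; split=> [g|c|g h|g h].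
- exact: x0.
- by rewrite comp_polyC.
- by rewrite comp_polyM.
- by rewrite comp_polyD.
Qed.

(* The extension to the projective line of a nonconstant polynomial, for which
   the point at infinity is fixed. *)
Definition berk_poly (P : {poly K}) (x : berkP1) : berkP1 :=
  if x is Some x' then Some (SigSub (berk_push_subproof P x'))
  else None.

End Berkovich.

Section Family.
Context {R : realType} {K : fieldType} (v : ultranorm R K) (p : nat).

Definition param_set : set K :=
  [set a | 1 < v a /\ v (a * p%:R ^+ (p - 1)) <= 1].

Definition Pa (a : K) : {poly K} := a *: 'X^p + (1 - a) *: 'X^(p + 1).

Definition Pa_map (a : K) : K -> K := fun z => (Pa a).[z].

Definition filled_Julia (a : K) : set K :=
  [set z | exists C : R, forall n, (1 <= n)%N -> v (iter n (Pa_map a) z) <= C].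

Definition Julia_component_ball (a z0 : K) (r : R) : Prop :=
  [/\ 0 < r, closed_disk v z0 r `<=` filled_Julia a &
      forall r', r < r' -> ~ (open_disk v z0 r' `<=` filled_Julia a)].

Definition nontrivial_wandering_ball (a z0 : K) (r : R) : Prop :=
  [/\ Julia_component_ball a z0 r,
      wandering (Pa_map a) (closed_disk v z0 r) &
      exists W : set (berkP1 v),
        nontrivial_wandering_Fatou_component (berk_poly (Pa a)) W /\
        open_disk v z0 r = berk_of v @^-1` W].

(* [false] stands for the symbol 0 and [true] for the symbol 1. *)
Definition is_itinerary (a x : K) (theta : nat -> bool) : Prop :=
  forall i, open_disk v (theta i)%:R 1 (iter i (Pa_map a) x).

End Family.

(* The infinite word 0^(m 0) 1^(M 0) 0^(m 1) 1^(M 1) ... ; when all the m j are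
   positive, its first [n.+1] pairs of blocks cover the index [n]. *)
Definition block_word (m M : nat -> nat) (n : nat) : bool :=
  nth false (flatten [seq nseq (m j) false ++ nseq (M j) true | j <- iota 0 n.+1])
    n.

Section Exponents.
Context (R : realType) (p : nat) (l : nat -> nat).

Definition q_exp : nat := ((p - 1) * (2 * p ^ 2 - 2 * p - 1))%N.

Definition kappa : R :=
  p%:R ^+ (2 * p - 2) / (p%:R ^+ (2 * p - 1) - p%:R + 1).

Definition t_term (s : nat) : R :=
  1 / p%:R ^+ (q_exp * l s + s)
  * (1 - kappa / p%:R ^+ (2 * (p - 1) ^ 3 * (l s.+1 - l s))).

Definition t_exp : R :=
  - (p%:R / (p%:R - 1) ^+ 2)
  + (p%:R ^+ (2 * p - 1) - p%:R + 1)
    / ((p%:R - 1) ^+ 2 * p%:R ^+ (2 * p + 1) * (p%:R ^+ (2 * p - 2) - 1))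
    * limn (series t_term).

End Exponents.

Section Blocks.
Context (p : nat) (l s : nat -> nat).

Definition M_seq (k : nat) : nat := (2 * k + 2 + (2 * p - 3) * l (s k))%N.

Definition m_seq (k : nat) : nat :=
  if k is k'.+1 then ((p - 1) * M_seq k' + 2 * p + 1)%N else (2 * p + 1)%N.

End Blocks.

(* Main.v *)
Require Import Defs.
From mathcomp Require Import all_boot all_order all_algebra.
From mathcomp Require Import boolp classical_sets functions cardinality.
From mathcomp Require Import reals topology normedtype sequences exp.
From mathcomp Require Import zify ring lra.
Import Order.TTheory GRing.Theory Num.Theory.
Import numFieldNormedType.Exports.
Local Open Scope classical_set_scope.
Local Open Scope ring_scope.

(** Write A = |a| and measure radii by their exponents in base A.  On B(1) the map
    P_a multiplies distances by A; around a point z of B(0) with |z| = A^(-zeta),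
    outside the basin of 0, it maps the disk of radius A^rho onto the disk of
    radius A^(1 + max(p rho, rho - p zeta)).  Along the prescribed itinerary the
    linear regime contracts disks during a block of zeros about as much as the
    blocks of ones expand them, and t is tuned so that the radius is just on the
    nonlinear side of the threshold p rho = rho - p zeta at the first step of the
    blocks of index l_s (p - 1)^2, and on the linear side at all other steps.
    There a larger radius has its excess multiplied by p, so every larger disk
    eventually covers the repelling fixed point 1, while the images of the ball of
    radius A^t stay in B(0) and B(1).

    The point x0 is fixed once and for all and the parameter moves: a_k sends x0
    to 1 at the end of the k-th block of zeros, and a perturbation of a_k of size
    A^(1 - M_k) moves the image of x0 after the next block of ones over the unit
    disk, which leaves room to choose a_(k+1); then a is the limit of the a_k.

    In the Berkovich line the boundary point of the ball lies in the Julia set: its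
    neighbourhoods contain disks meeting the backward orbit of 1, whose iterates
    exhaust the affine line because closed disks are compact and the points of K
    are dense in them.  Hence the open ball is the trace of a Fatou component, and
    the orbits in it accumulate at 1 but visit B(0) infinitely often, so they are
    not asymptotic to a periodic orbit. *)

(** * Ultrametric norms and polynomial maps of disks *)

Section Ultranorm.
Context {R : realType} {K : fieldType} (v : ultranorm R K).
Implicit Types (x y z : K) (g h : {poly K}).

Lemma un0 : v 0 = 0. Proof. exact: (proj2 (ultranorm_eq0 v 0)). Qed.

Lemma un_gt0 x : (0 < v x) = (x != 0).
Proof.
rewrite lt_def ultranorm_ge0 andbT; congr (~~ _).
by apply/eqP/eqP => /(ultranorm_eq0 v).
Qed.

Lemma un1 : v 1 = 1.
Proof.
have v1 : 0 < v 1 by rewrite un_gt0 oner_eq0.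
by apply: (mulfI (lt0r_neq0 v1)); rewrite -ultranormM !mulr1.
Qed.

Lemma unX x n : v (x ^+ n) = v x ^+ n.
Proof. by elim: n => [|n IH]; rewrite ?expr0 ?un1// !exprS ultranormM IH. Qed.

Lemma unN x : v (- x) = v x.
Proof.
suff vN1 : v (-1) = 1 by rewrite -mulN1r ultranormM vN1 mul1r.
have /eqP := unX (-1) 2; rewrite sqrrN expr1n un1 eq_sym sqrf_eq1.
by case/orP => /eqP // vN; have := ultranorm_ge0 v (-1); rewrite vN ler0N1.
Qed.

Lemma un_distC x y : v (x - y) = v (y - x).
Proof. by rewrite -unN opprB. Qed.

Lemma unV x : v x^-1 = (v x)^-1.
Proof.
have [->|x0] := eqVneq x 0; first by rewrite invr0 un0 invr0.
have vx : v x != 0 by rewrite lt0r_neq0// un_gt0.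
by apply: (mulfI vx); rewrite -ultranormM !divff// un1.
Qed.

Lemma unB x y : v (x - y) <= Num.max (v x) (v y).
Proof. by rewrite -(unN y) ultranormD. Qed.

Lemma unD_le x y (c : R) : v x <= c -> v y <= c -> v (x + y) <= c.
Proof. by move=> xc yc; apply: le_trans (ultranormD v x y) _; rewrite ge_max xc. Qed.

Lemma unB_le x y (c : R) : v x <= c -> v y <= c -> v (x - y) <= c.
Proof. by move=> xc yc; apply: unD_le; rewrite ?unN. Qed.

Lemma unD_lt x y (c : R) : v x < c -> v y < c -> v (x + y) < c.
Proof. by move=> xc yc; apply: le_lt_trans (ultranormD v x y) _; rewrite gt_max xc. Qed.

Lemma unD_eq x y : v y < v x -> v (x + y) = v x.
Proof.
move=> yx; apply/le_anti/andP; split; first by apply: unD_le => //; exact: ltW.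
have : v x <= Num.max (v (x + y)) (v y) by rewrite -{1}(addrK y x) unB.
by rewrite le_max => /orP[//|]; rewrite leNgt yx.
Qed.

Lemma unD_eqr x y : v x < v y -> v (x + y) = v y.
Proof. by move=> xy; rewrite addrC unD_eq. Qed.

Lemma un_eq_of_close x y : v (x - y) < v x -> v y = v x.
Proof. by move=> xy; rewrite -(subKr x y) unD_eq// unN. Qed.

Lemma un_sum_le (I : Type) (r : seq I) (P : pred I) (F : I -> K) (c : R) : 0 <= c ->
  (forall i, P i -> v (F i) <= c) -> v (\sum_(i <- r | P i) F i) <= c.
Proof.
move=> c0 Fc; elim/big_rec: _ => [|i x Pi xc]; first by rewrite un0.
by rewrite unD_le// Fc.
Qed.

Lemma un_sum_lt (I : Type) (r : seq I) (P : pred I) (F : I -> K) (c : R) : 0 < c ->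
  (forall i, P i -> v (F i) < c) -> v (\sum_(i <- r | P i) F i) < c.
Proof.
move=> c0 Fc; elim/big_rec: _ => [|i x Pi xc]; first by rewrite un0.
by rewrite unD_lt// Fc.
Qed.

Lemma un_nat n : v n%:R <= 1.
Proof. by elim: n => [|n IH]; rewrite ?un0// -natr1 unD_le// un1. Qed.

End Ultranorm.

(** * Taylor expansion of polynomials over a field *)

Section Taylor.
Context {K : fieldType}.
Implicit Types (F : {poly K}) (z : K).

(** This is the Hasse derivative of order j at z; no division by j! occurs, so it makes sense in
    every characteristic. *)
Definition taylor_coef F z (j : nat) : K := (F \Po ('X + z%:P))`_j.

Lemma taylor_coef0 F z : taylor_coef F z 0 = F.[z].
Proof. by rewrite /taylor_coef -horner_coef0 horner_comp !hornerE. Qed.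

Lemma taylor_sub F z : exists n, F - (F.[z])%:P =
  \sum_(i < n) taylor_coef F z i.+1 *: ('X - z%:P) ^+ i.+1.
Proof.
set g := F \Po ('X + z%:P); exists (size g).-1.
have EF : F = g \Po ('X - z%:P).
  by rewrite /g -comp_polyA comp_polyD comp_polyX comp_polyC subrK comp_polyXr.
rewrite -taylor_coef0 {1}EF comp_polyE /taylor_coef -/g.
case sg: (size g) => [|n]; last by rewrite big_ord_recl/= expr0 alg_polyC addrC addKr.
by rewrite !big_ord0 sub0r nth_default ?oppr0// sg.
Qed.

Lemma horner_taylor_sub F z : exists n, forall z', F.[z'] - F.[z] =
  \sum_(i < n) taylor_coef F z i.+1 * (z' - z) ^+ i.+1.
Proof.
have [n En] := taylor_sub F z; exists n => z'.
transitivity ((F - (F.[z])%:P).[z']); first by rewrite !hornerE.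
by rewrite En horner_sum; apply: eq_bigr => i _; rewrite !hornerE.
Qed.

Lemma coef_exp_XaddC z n j : (('X + z%:P) ^+ n)`_j = z ^+ (n - j) *+ 'C(n, j).
Proof.
elim: n j => [|n IH] j; first by rewrite expr0 coef1; case: j => [|j]; rewrite ?expr0.
rewrite exprS mulrDl coefD coefXM coefCM !IH; case: j => [|j] /=.
  by rewrite !bin0 !subn0 add0r exprS.
rewrite subSS binS mulrnDr addrC; congr (_ + _).
have [nj|jn] := leqP n j; first by rewrite !bin_small ?mulr0n ?mulr0// ltnS.
by rewrite mulrnAr -exprS -subSn.
Qed.

Lemma taylor_coefD F G z j : taylor_coef (F + G) z j = taylor_coef F z j + taylor_coef G z j.
Proof. by rewrite /taylor_coef comp_polyD coefD. Qed.

Lemma taylor_coefZ (c : K) F z j : taylor_coef (c *: F) z j = c * taylor_coef F z j.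
Proof. by rewrite /taylor_coef comp_polyZ coefZ. Qed.

Lemma taylor_coefXn n z j : taylor_coef 'X^n z j = z ^+ (n - j) *+ 'C(n, j).
Proof. by rewrite /taylor_coef comp_Xn_poly coef_exp_XaddC. Qed.

End Taylor.

Section Disks.
Context {R : realType} {K : closedFieldType} (v : ultranorm R K).
Implicit Types (x y z : K) (g h : {poly K}).


(* By Vieta, this holds as soon as g has no root in the disk |z| <= s.  Taking
   g = F - c, this shows that F takes the value c on a disk as soon as one of its
   Taylor coefficients is large enough. *)
Definition coef_dominated (s : R) g :=
  forall j, (0 < j)%N -> v g`_j * s ^+ j < v g`_0.

(** In each term of the coefficient of degree j > 0, the power s^j splits as s^i s^(j-i) with i or j
    - i positive: one factor is strictly dominated and the other weakly. *)
Lemma coef_dominatedM (s : R) g h : 0 < s ->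
  coef_dominated s g -> coef_dominated s h -> coef_dominated s (g * h).
Proof.
move=> s0 dg dh.
have lead f : coef_dominated s f -> 0 < v f`_0.
  move=> df; apply: le_lt_trans (df 1%N isT).
  by rewrite mulr_ge0 ?ultranorm_ge0// exprn_ge0 ?ltW.
have bnd f : coef_dominated s f -> forall j, v f`_j * s ^+ j <= v f`_0.
  by move=> df [|j]; rewrite ?expr0 ?mulr1// ltW// df.
move=> j j0; rewrite coef0M ultranormM coefM -ltr_pdivlMr ?exprn_gt0//.
apply: un_sum_lt => [|i _].
  by rewrite divr_gt0 ?exprn_gt0// mulr_gt0// lead.
rewrite ltr_pdivlMr ?exprn_gt0// ultranormM.
have -> : s ^+ j = s ^+ i * s ^+ (j - i) by rewrite -exprD subnKC// -ltnS.
rewrite mulrACA; have [->|i0] := posnP i.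
  by rewrite expr0 mulr1 subn0 ltr_pM2l ?dh ?lead.
apply: le_lt_trans (ler_wpM2l _ (bnd _ dh _)) _; last by rewrite ltr_pM2r ?dg ?lead.
by rewrite mulr_ge0 ?ultranorm_ge0// exprn_ge0 ?ltW.
Qed.

Lemma coef_dominated_no_root (s : R) g : 0 < s ->
  (forall z, v z <= s -> g.[z] != 0) -> coef_dominated s g.
Proof.
move=> s0 nr; have [r Er] := closed_field_poly_normal g.
have g0 : g != 0.
  by apply: contraTneq (nr 0 _) => [->|]; rewrite ?horner0 ?eqxx// un0 ltW.
have rs z : z \in r -> s < v z.
  move=> zr; rewrite ltNge; apply/negP => /nr; rewrite Er hornerZ.
  have /rootP -> : root (\prod_(z <- r) ('X - z%:P)) z by rewrite root_prod_XsubC.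
  by rewrite mulr0 eqxx.
rewrite Er -mul_polyC; apply: coef_dominatedM => //.
  move=> j j0; rewrite !coefC /= -[j == 0%N]negbK -lt0n j0/= un0 mul0r un_gt0.
  by rewrite lead_coef_eq0.
elim: r rs {Er} => [|z r IH] rs.
  by rewrite big_nil => -[|j]// _; rewrite !coef1/= un0 mul0r un1.
rewrite big_cons; apply: coef_dominatedM => //; last first.
  by apply: IH => y yr; apply: rs; rewrite inE yr orbT.
move=> [//|[|j]] _; rewrite !coefB !coefX !coefC /= ?subr0 ?sub0r ?un1 ?unN ?un0 ?mul1r ?mul0r ?expr1.
  by rewrite rs// mem_head.
by apply: lt_trans s0 _; rewrite rs// mem_head.
Qed.

Lemma disk_surj_or_dominated (F : {poly K}) (u0 c : K) (s : R) : 0 < s ->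
  (exists2 u, v (u - u0) <= s & F.[u] = c) \/
  forall j, (0 < j)%N -> v (taylor_coef F u0 j) * s ^+ j < v (c - F.[u0]).
Proof.
move=> s0; have [|noroot] := pselect (exists2 u, v (u - u0) <= s & F.[u] = c); [by left|right].
pose g := F \Po ('X + u0%:P) - c%:P.
have dg : coef_dominated s g.
  apply: coef_dominated_no_root => // z zs.
  rewrite /g hornerD horner_comp !hornerE subr_eq0; apply/eqP => Fz; apply: noroot.
  by exists (z + u0) => //; rewrite addrK.
move=> j j0; have := dg j j0; rewrite /g !coefB !coefC eqxx -!/(taylor_coef _ _ _) taylor_coef0.
by rewrite eqn0Ngt j0/= subr0 un_distC.
Qed.

Lemma disk_surj (F : {poly K}) (u0 c : K) (s : R) (j : nat) : 0 < s -> (0 < j)%N ->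
  v (c - F.[u0]) <= v (taylor_coef F u0 j) * s ^+ j ->
  exists2 u, v (u - u0) <= s & F.[u] = c.
Proof.
move=> s0 j0 cj; have [//|/(_ j j0)] := disk_surj_or_dominated F u0 c _ s0.
by rewrite ltNge cj.
Qed.

(** If c were missed on the disk through u1, every Taylor term would be smaller than |c - F(u0)| at
    that radius, hence so would F(u1) - F(u0). *)
Lemma disk_surj_eval (F : {poly K}) (u0 u1 c : K) :
  v (c - F.[u0]) <= v (F.[u1] - F.[u0]) ->
  exists2 u, v (u - u0) <= v (u1 - u0) & F.[u] = c.
Proof.
have [->|u10] := eqVneq u1 u0.
  rewrite !subrr un0 => c0; exists u0; rewrite ?subrr ?un0//.
  apply/esym/subr0_eq/(ultranorm_eq0 v)/le_anti.
  by rewrite c0 ultranorm_ge0.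
have s0 : 0 < v (u1 - u0) by rewrite un_gt0 subr_eq0.
have [//|dom] := disk_surj_or_dominated F u0 c _ s0.
rewrite leNgt => /negP[].
have [n ->] := horner_taylor_sub F u0.
apply: un_sum_lt => [|i _]; last by rewrite ultranormM unX dom.
by apply: le_lt_trans (dom 1%N isT); rewrite mulr_ge0 ?ultranorm_ge0// exprn_ge0 ?ltW.
Qed.

End Disks.

(** * The family P_a *)

Section Family.
Context {R : realType} {K : fieldType} (v : ultranorm R K) (p : nat).
Hypotheses (p_prime : prime p) (vp : v p%:R < 1).
Implicit Types (a z : K).

Let p_gt0 : (0 < p)%N. Proof. exact: prime_gt0. Qed.

Lemma Pa_mapE a z : Pa_map p a z = z ^+ p * (a + (1 - a) * z).
Proof. by rewrite /Pa_map /Pa !hornerE addn1 exprSr; ring. Qed.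

Lemma Pa_map1 a : Pa_map p a 1 = 1.
Proof. by rewrite Pa_mapE expr1n mulr1 mul1r addrC subrK. Qed.

Lemma Pa_map0 a : Pa_map p a 0 = 0.
Proof. by rewrite Pa_mapE expr0n gtn_eqF// mul0r. Qed.

Lemma taylor_coef_Pa a z j : taylor_coef (Pa p a) z j =
  a * (z ^+ (p - j) *+ 'C(p, j)) + (1 - a) * (z ^+ (p + 1 - j) *+ 'C(p + 1, j)).
Proof. by rewrite /Pa taylor_coefD !taylor_coefZ !taylor_coefXn. Qed.

Lemma un_mulrn_le z n : v (z *+ n) <= v z.
Proof. by rewrite -mulr_natr ultranormM ler_piMr ?ultranorm_ge0// un_nat. Qed.

Lemma un_mulrn_dvd z n : (p %| n)%N -> v (z *+ n) <= v p%:R * v z.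
Proof.
case/dvdnP => k ->; rewrite mulnC mulrnA -[z *+ p]mulr_natl -mulrnAr ultranormM.
by rewrite ler_wpM2l ?ultranorm_ge0// un_mulrn_le.
Qed.

Lemma un_pS : v (p + 1)%:R = 1.
Proof. by rewrite natrD addrC unD_eq ?un1. Qed.

Section Fixed_parameter.
Variable a : K.
Hypothesis va : 1 < v a.

Lemma un_1a : v (1 - a) = v a.
Proof. by rewrite unD_eqr unN// un1. Qed.

Let va0 : 0 < v a. Proof. exact: lt_trans va. Qed.

Lemma un_Pa0 z : v z < 1 -> v (Pa_map p a z) = v a * v z ^+ p.
Proof.
move=> z1; rewrite Pa_mapE ultranormM unX mulrC unD_eq// ultranormM un_1a.
by rewrite gtr_pMr.
Qed.

Lemma un_Pa_gt1 z : 1 < v z -> v (Pa_map p a z) = v a * v z ^+ p.+1.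
Proof.
move=> z1; rewrite Pa_mapE ultranormM unX exprSr mulrCA; congr (_ * _).
by rewrite unD_eqr ultranormM un_1a// ltr_pMr.
Qed.

(** The derivative is z^(p-1) (a p + (1-a)(p+1) z). Since p + 1 is a unit and |p| < |z|, the second
    summand dominates. *)
Lemma un_taylor1 z : v p%:R < v z ->
  v (taylor_coef (Pa p a) z 1) = v a * v z ^+ p.
Proof.
move=> pz; rewrite taylor_coef_Pa !bin1 addnK.
have -> : a * (z ^+ (p - 1) *+ p) + (1 - a) * (z ^+ p *+ (p + 1)) =
   z ^+ p.-1 * (a * p%:R + (1 - a) * ((p + 1)%:R * z)).
  have -> : z ^+ p = z ^+ p.-1 * z by rewrite -exprSr prednK.
  by rewrite subn1 -[_ *+ p]mulr_natr -[_ *+ (p + 1)]mulr_natr; ring.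
have -> : v z ^+ p = v z ^+ p.-1 * v z by rewrite -exprSr prednK.
rewrite ultranormM unX [RHS]mulrCA; congr (_ * _).
have E : v ((1 - a) * ((p + 1)%:R * z)) = v a * v z.
  by rewrite !ultranormM un_1a un_pS mul1r.
by rewrite unD_eqr E// ultranormM ltr_pM2l.
Qed.

Lemma un_taylor_le z j : v z <= 1 -> v (taylor_coef (Pa p a) z j) <= v a.
Proof.
move=> z1; have Xle n k : v (z ^+ n *+ k) <= 1.
  by apply: le_trans (un_mulrn_le _ _) _; rewrite unX exprn_ile1 ?ultranorm_ge0.
rewrite taylor_coef_Pa; apply: unD_le; rewrite ultranormM ?un_1a.
  by rewrite ler_piMr// ltW.
by rewrite ler_piMr// ltW.
Qed.

Lemma un_taylorp z : v z < 1 -> v (taylor_coef (Pa p a) z p) = v a.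
Proof.
move=> z1; rewrite taylor_coef_Pa subnn expr0 binn mulr1 (addnC p 1%N) addnK.
rewrite unD_eq// expr1 ultranormM un_1a gtr_pMr//.
exact: le_lt_trans (un_mulrn_le _ _) z1.
Qed.

(** For these j both binomial coefficients 'C(p, j) and 'C(p + 1, j) are divisible by p, which gives
    the factor |p|. *)
Lemma un_taylor_mid z j : v z <= 1 -> (1 < j < p)%N ->
  v (taylor_coef (Pa p a) z j) <= v a * (v p%:R * v z ^+ (p - j)).
Proof.
case: j => [//|j] z1 /andP[j1 jp]; rewrite taylor_coef_Pa.
have pC : (p %| 'C(p, j.+1))%N by rewrite prime_dvd_bin.
have pC1 : (p %| 'C(p + 1, j.+1))%N.
  by rewrite addn1 binS dvdn_add// prime_dvd_bin// -ltnS j1 ltnW.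
apply: unD_le; rewrite ultranormM ?un_1a ler_pM2l//; apply: le_trans (un_mulrn_dvd _ _ _) _ => //.
  by rewrite unX.
rewrite unX ler_wpM2l ?ultranorm_ge0// addn1 subSS.
by rewrite ler_wiXn2l ?ultranorm_ge0// leq_sub2l.
Qed.

(* Near a point z of B(0) with |z| > |p| only the terms of degree 1 and p of the
   Taylor expansion matter. *)
Lemma taylor_Pa_bound0 z (u : R) j : v p%:R < v z -> v z < 1 -> 0 <= u ->
  u < v z -> (0 < j)%N ->
  v (taylor_coef (Pa p a) z j) * u ^+ j <=
    Num.max (v a * u ^+ p) (v a * v z ^+ p * u).
Proof.
move=> pz z1 u0 uz j0; have u1 : u <= 1 by rewrite ltW// (lt_trans uz).
have [jp|jp] := leqP p j.
  rewrite le_max; apply/orP; left; apply: ler_pM; rewrite ?ultranorm_ge0 ?exprn_ge0//.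
    by apply: un_taylor_le; exact: ltW.
  by rewrite ler_wiXn2l.
rewrite le_max; apply/orP; right; case: (ltngtP j 1) j0 => // [j1 _|-> _]; last first.
  by rewrite un_taylor1.
apply: le_trans (ler_wpM2r (exprn_ge0 _ u0) (un_taylor_mid _ _ (ltW z1) _)) _.
  by rewrite j1.
have -> : u ^+ j = u ^+ j.-1 * u by rewrite -exprSr prednK// ltnW.
rewrite [leLHS]mulrA ler_wpM2r// -[leLHS]mulrA ler_pM2l//.
(* Bounding |p| by |z| and u^(j-1) by |z|^(j-1) completes |z|^(p-j) to |z|^p. *)
have -> : v z ^+ p = v z * (v z ^+ (p - j) * v z ^+ j.-1).
  by rewrite -exprD -exprS; congr (_ ^+ _); lia.
rewrite -mulrA ler_pM ?mulr_ge0 ?exprn_ge0 ?ultranorm_ge0 ?(ltW pz)//.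
by rewrite ler_wpM2l ?exprn_ge0 ?ultranorm_ge0// lerXn2r ?nnegrE ?ultranorm_ge0 ?(ltW uz).
Qed.

Lemma taylor_Pa_bound1 z (u : R) j : v z <= 1 -> 0 <= u -> u <= 1 -> (0 < j)%N ->
  v (taylor_coef (Pa p a) z j) * u ^+ j <= v a * u.
Proof.
move=> z1 u0 u1 j0; apply: ler_pM; rewrite ?ultranorm_ge0 ?exprn_ge0 ?un_taylor_le//.
by rewrite -[leRHS]expr1 ler_wiXn2l.
Qed.

Lemma un_near1 z : v (z - 1) < 1 -> v z = 1.
Proof. by move=> z1; rewrite (un_eq_of_close v 1 z) un1// un_distC. Qed.

Lemma un_PaB0 z z' : v p%:R < v z -> v z < 1 -> v (z' - z) < v z ->
  v (Pa_map p a z' - Pa_map p a z) <=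
    Num.max (v a * v (z' - z) ^+ p) (v a * v z ^+ p * v (z' - z)).
Proof.
move=> pz z1 zz; have [n ->] := horner_taylor_sub (Pa p a) z.
apply: un_sum_le => [|i _].
  by rewrite le_max mulr_ge0 ?exprn_ge0 ?ultranorm_ge0.
by rewrite ultranormM unX taylor_Pa_bound0 ?ultranorm_ge0.
Qed.

Lemma un_PaB1 z z' : v (z - 1) < 1 -> v (z' - z) < 1 ->
  v (Pa_map p a z' - Pa_map p a z) = v a * v (z' - z).
Proof.
move=> z1 zz; have [->|z'z] := eqVneq z' z; first by rewrite !subrr un0 mulr0.
have vz := un_near1 _ z1.
have h0 : 0 < v (z' - z) by rewrite un_gt0 subr_eq0.
have c1 : v (taylor_coef (Pa p a) z 1) = v a by rewrite un_taylor1 vz ?expr1n ?mulr1.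
have [n] := horner_taylor_sub (Pa p a) z; rewrite -/(Pa_map p a z).
case: n => [|n] En.
  (* An empty expansion would make the map constant, but it vanishes at 0 and not at a. *)
  have := un_Pa_gt1 a; have := En 0; have := En a; rewrite !big_ord0.
  rewrite -!/(Pa_map p a _) Pa_map0 sub0r => /eqP; rewrite subr_eq0 => /eqP Ea /eqP.
  rewrite oppr_eq0 => /eqP E0 /(_ va); rewrite Ea E0 un0 => /esym/eqP.
  by rewrite mulf_eq0 expf_eq0/= orbb gt_eqF.
rewrite /Pa_map En big_ord_recl /= expr1.
have E1 : v (taylor_coef (Pa p a) z 1 * (z' - z)) = v a * v (z' - z) by rewrite ultranormM c1.
rewrite [LHS]unD_eq E1//; apply: un_sum_lt => [|i _]; first by rewrite mulr_gt0.
rewrite ultranormM unX; apply: (@le_lt_trans _ _ (v a * v (z' - z) ^+ 2)).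
  apply: ler_pM; rewrite ?exprn_ge0 ?ultranorm_ge0 ?un_taylor_le ?vz//=.
  by rewrite ler_wiXn2l ?ultranorm_ge0 ?ltW.
by rewrite ltr_pM2l// expr2 gtr_pMr.
Qed.

End Fixed_parameter.

Lemma Pa_map_paramB a a' z :
  v (Pa_map p a z - Pa_map p a' z) = v (a - a') * (v z ^+ p * v (z - 1)).
Proof.
rewrite !Pa_mapE -mulrBr.
have -> : a + (1 - a) * z - (a' + (1 - a') * z) = (a - a') * (1 - z) by ring.
by rewrite !ultranormM unX mulrCA un_distC (un_distC v 1).
Qed.

Lemma param_setE a : param_set v p a -> v p%:R ^+ (p - 1) <= (v a)^-1.
Proof.
case=> a1 ap; have a0 : 0 < v a by apply: lt_trans a1.
by rewrite -(ler_pM2l a0) divff ?gt_eqF// -unX -ultranormM.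
Qed.

End Family.

(** * Real powers and radii of the spheres in B(0) *)

Section Real_powers.
Context {R : realType}.
Variable A : R.
Hypothesis A1 : 1 < A.
Implicit Types x y : R.

Let A0 : 0 < A. Proof. exact: lt_trans A1. Qed.

Lemma powR_gt1D x y : A `^ (x + y) = A `^ x * A `^ y.
Proof. by apply: powRD; apply/implyP => _; rewrite gt_eqF. Qed.

Lemma powR_gt1X x n : (A `^ x) ^+ n = A `^ (n%:R * x).
Proof. by rewrite -powR_mulrn ?powR_ge0// -powRrM mulrC. Qed.

Lemma ltr_powR_gt1 x y : (A `^ x < A `^ y) = (x < y).
Proof. by rewrite /powR gt_eqF// ltr_expR ltr_pM2r// ln_gt0. Qed.

Lemma ler_powR_gt1 x y : (A `^ x <= A `^ y) = (x <= y).
Proof. by rewrite leNgt ltr_powR_gt1 -leNgt. Qed.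

Lemma powR_gt1_onto y : 0 < y -> exists x, y = A `^ x.
Proof.
move=> y0; exists (ln y / ln A); rewrite /powR gt_eqF// divfK ?lnK//.
by rewrite gt_eqF// ln_gt0.
Qed.

Lemma exprn_unbounded y : exists n, y < A ^+ n.
Proof.
have d0 : 0 < A - 1 by rewrite subr_gt0.
have bnd k : 1 + k%:R * (A - 1) <= A ^+ k.
  elim: k => [|k IH]; first by rewrite mul0r addr0 expr0.
  rewrite exprSr -natr1; have k0 : 0 <= k%:R :> R by [].
  apply: le_trans (ler_wpM2r (ltW A0) IH).
  rewrite -subr_ge0 (_ : _ - _ = k%:R * (A - 1) ^+ 2); last by ring.
  by rewrite mulr_ge0 ?sqr_ge0.
have := archi_boundP (normr_ge0 (y / (A - 1))); set n := Num.bound _ => yn.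
exists n; apply: lt_le_trans (bnd n).
have : y / (A - 1) < n%:R by apply: le_lt_trans (ler_norm _) yn.
by rewrite ltr_pdivrMr// => h; rewrite (lt_trans h)// ltrDr.
Qed.

End Real_powers.

(* The point z of B(0) at distance A^(- zeta j) from 0, where A = |a|, leaves
   B(0) after exactly j iterations, and zeta_sum j is the exponent of the factor
   by which these iterations expand a small disk around z. *)
Section Zeta.
Context {R : realType}.
Variable p : nat.
Hypothesis p2 : (1 < p)%N.

Fixpoint zeta (j : nat) : R := if j is i.+1 then (zeta i + 1) / p%:R else 0.

Fixpoint zeta_sum (j : nat) : R := if j is i.+1 then zeta_sum i - zeta i else 0.

Let p0 : 0 < p%:R :> R. Proof. by rewrite ltr0n ltnW. Qed.
Let p1 : 1 < p%:R :> R. Proof. by rewrite ltr1n. Qed.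

Lemma zeta_closed j : (p%:R - 1) * zeta j = 1 - (p%:R ^+ j)^-1 :> R.
Proof.
elim: j => [|j IH] /=; first by rewrite expr0 invr1 subrr mulr0.
rewrite exprS invfM mulrA mulrDr IH mulr1; field.
by rewrite expf_neq0 gt_eqF.
Qed.

Lemma zeta_rec j : p%:R * zeta j.+1 = zeta j + 1.
Proof. by rewrite /= mulrC divfK// gt_eqF. Qed.

Lemma zeta_ge0 j : 0 <= zeta j.
Proof. by elim: j => //= j IH; rewrite divr_ge0// ?addr_ge0// ltW. Qed.

Lemma zetaS_gt0 j : 0 < zeta j.+1.
Proof. by rewrite /= divr_gt0// ltr_wpDl// zeta_ge0. Qed.

Lemma zeta_lt j : (p%:R - 1) * zeta j < 1.
Proof. by rewrite zeta_closed gtrBl invr_gt0 exprn_gt0. Qed.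

Lemma zeta_lt1 j : zeta j < 1.
Proof.
apply: le_lt_trans (zeta_lt j); rewrite ler_peMl ?zeta_ge0//.
by rewrite lerBrDr -[1 + 1]/(2%:R) ler_nat.
Qed.

Lemma zeta_sum_le0 j : zeta_sum j <= 0.
Proof. by elim: j => //= j IH; rewrite subr_le0 (le_trans IH)// zeta_ge0. Qed.

Lemma zeta_sum_closed j : (p%:R - 1) * zeta_sum j =
  - j%:R + p%:R / (p%:R - 1) * (1 - (p%:R ^+ j)^-1) :> R.
Proof.
elim: j => [|j IH] /=; first by rewrite expr0 invr1 subrr !mulr0 oppr0 addr0.
rewrite mulrBr IH zeta_closed exprS invfM -natr1; field.
by rewrite expf_neq0 ?gt_eqF// subr_gt0.
Qed.

End Zeta.

(** * Dependence of orbits on the parameter *)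

Section Orbits.
Context {R : realType} {K : fieldType} (v : ultranorm R K) (p : nat) (A : R).
Hypotheses (p_prime : prime p) (vp : v p%:R < 1) (A1 : 1 < A).
Hypothesis vpA : v p%:R ^+ (p - 1) <= A^-1.
Implicit Types (a z : K) (i j : nat).

Local Notation "A^ x" := (A `^ x) (at level 5, x at level 5).
Local Notation zeta := (@zeta R p).
Local Notation Psi := (@zeta_sum R p).
Local Notation F a := (Pa_map p a).

Let p2 : (1 < p)%N. Proof. exact: prime_gt1. Qed.
Let A0 : 0 < A. Proof. exact: lt_trans A1. Qed.
Let pB : (p - 1)%:R = p%:R - 1 :> R. Proof. by rewrite natrB// ltnW. Qed.
Let p11 : 1 <= p%:R - 1 :> R.
Proof. by rewrite -pB -[1]/(1%:R) ler_nat subn_gt0. Qed.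
Let E0 : A^(0) = 1. Proof. exact: powRr0. Qed.
Let E1 : A^(1) = A. Proof. by rewrite powRr1// ltW. Qed.
Let E_gt0 (x : R) : 0 < A^(x). Proof. exact: powR_gt0. Qed.
Let ED (x y : R) : A^(x + y) = A^(x) * A^(y). Proof. exact: powR_gt1D. Qed.
Let Elt (x y : R) : (A^(x) < A^(y)) = (x < y). Proof. exact: ltr_powR_gt1. Qed.
Let Ele (x y : R) : (A^(x) <= A^(y)) = (x <= y). Proof. exact: ler_powR_gt1. Qed.
Let Elt1 (x : R) : (A^(x) < 1) = (x < 0). Proof. by rewrite -E0 Elt. Qed.
Let Ele1 (x : R) : (A^(x) <= 1) = (x <= 0). Proof. by rewrite -E0 Ele. Qed.

(** The condition on the parameter gives |p| <= A^(-1/(p-1)), whereas zeta j < 1/(p-1). Thus the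
    estimates requiring |z| > |p| apply on all these spheres. *)
Lemma vp_lt_sphere j : v p%:R < A^(- zeta j).
Proof.
rewrite ltNge; apply/negP => h.
have := lerXn2r (p - 1) _ _ h; rewrite !nnegrE powR_ge0 ultranorm_ge0 => /(_ isT isT).
move=> /le_trans/(_ vpA). rewrite powR_gt1X// -powR_inv1 ?(ltW A0)// Ele.
by have := @zeta_lt R p p2 j; rewrite pB; lra.
Qed.

Lemma step_sphere a z j : v a = A -> v z = A^(- zeta j.+1) ->
  v (F a z) = A^(- zeta j).
Proof.
move=> va vz; have zj := @zetaS_gt0 R p p2 j.
rewrite (un_Pa0 v p) ?va ?vz ?powR_gt1X//; last by rewrite Elt1; lra.
by rewrite -{1}E1 -ED; congr (_ `^ _); have := @zeta_rec R p p2 j; lra.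
Qed.

Lemma iter_sphere a z j i : v a = A -> v z = A^(- zeta j) -> (i <= j)%N ->
  v (iter i (F a) z) = A^(- zeta (j - i)).
Proof.
move=> va vz; elim: i => [|i IH] ij; first by rewrite subn0.
by apply: step_sphere => //; rewrite subnSK// IH// ltnW.
Qed.

(** This serves to bound |z| from below when the j-th iterate of z is known to be 1. *)
Lemma iter_in_sphere a z j : v a = A -> v z < A^(- zeta j) ->
  v (iter j (F a) z) < 1.
Proof.
move=> va; elim: j z => [|j IH] z vz; first by rewrite -(@powRr0 _ A) -oppr0.
rewrite iterSr; apply: IH; have zj := @zetaS_gt0 R p p2 j.
have z1 : v z < 1 by apply: lt_le_trans vz _; rewrite Ele1; lra.
rewrite (un_Pa0 v p) ?va//.
have -> : A^(- zeta j) = A * A^(- zeta j.+1) ^+ p.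
  by rewrite powR_gt1X// -{2}E1 -ED; congr (_ `^ _); have := @zeta_rec R p p2 j; lra.
rewrite ltr_pM2l// ltrXn2r// ?nnegrE ?powR_ge0 ?ultranorm_ge0//.
by rewrite -lt0n ltnW.
Qed.

Lemma iter_near1 a z i (M : R) : v a = A -> v (z - 1) <= A^(- M) -> i%:R - M <= 0 ->
  v (iter i (F a) z - 1) <= A^(i%:R - M).
Proof.
move=> va zM; elim: i => [|i IH]; first by rewrite sub0r.
rewrite -natr1 => iM; have zi : v (iter i (F a) z - 1) <= A^(i%:R - M) by apply: IH; lra.
rewrite iterS -(Pa_map1 p a) (un_PaB1 v p) ?va ?subrr ?un0//.
  have -> : i%:R + 1 - M = 1 + (i%:R - M) by lra.
  by rewrite ED E1 ler_pM2l.
by apply: le_lt_trans zi _; rewrite Elt1; lra.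
Qed.

Section Shadowing.
Variables (a a' : K) (d : R).
Hypotheses (va : v a = A) (va' : v a' = A) (da : v (a' - a) = A^(d)).

(** The difference is split into the displacement of the point, which is in the linear regime, and
    the change of parameter, whose size is exactly A^d |z|^p. At the last step of a block (j = 0)
    the linear factor is 1, so the larger of the two is decided by D alone. *)
Lemma shadow_step0 z z' j (D : R) : v z = A^(- zeta j.+1) ->
  v (z' - z) <= D -> D <= A^(-2) ->
  v (F a' z' - F a z) <= Num.max (A^(- zeta j) * D) (A^(d - 1 - zeta j)) /\
  (D < A^(d - 1 - zeta j) -> j = 0%N -> v (F a' z' - F a z) = A^(d - 1 - zeta j)).
Proof.
move=> vz zD D2.
have zrec := @zeta_rec R p p2 j.
have zlt := @zeta_lt R p p2 j.+1.
have zj := @zetaS_gt0 R p p2 j.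
have zj0 := @zeta_ge0 R p j.
have z1 : v z < 1 by rewrite vz Elt1; lra.
have z11 : v (z - 1) = 1 by rewrite unD_eqr unN un1.
have D0 : 0 <= D by apply: le_trans zD; exact: ultranorm_ge0.
have -> : F a' z' - F a z = (F a' z' - F a' z) + (F a' z - F a z) by rewrite subrKA.
have s2 : v (F a' z - F a z) = A^(d - 1 - zeta j).
  rewrite Pa_map_paramB// da z11 mulr1 vz powR_gt1X// -ED; congr (_ `^ _).
  by have := zrec; lra.
have zz : v (z' - z) < v z.
  apply: le_lt_trans zD _; apply: le_lt_trans D2 _; rewrite vz Elt.
  by have := @zeta_lt1 R p p2 j.+1; have := p11; lra.
have s1 : v (F a' z' - F a' z) <= A^(- zeta j) * D.
  have -> : A^(- zeta j) = A * v z ^+ p.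
    rewrite vz powR_gt1X// -{2}E1 -ED; congr (_ `^ _); have := zrec; lra.
  apply: le_trans (un_PaB0 v p p_prime vp a' _ z z' _ z1 zz) _.
  - by rewrite va'.
  - by rewrite vz vp_lt_sphere.
  rewrite va' ge_max; apply/andP; split; last first.
    by rewrite ler_wpM2l// mulr_ge0 ?exprn_ge0 ?ultranorm_ge0// ltW.
  rewrite -mulrA ler_pM2l//.
  have -> : v (z' - z) ^+ p = v (z' - z) ^+ (p - 1) * v (z' - z).
    by rewrite -exprSr subn1 prednK// prime_gt0.
  apply: ler_pM; rewrite ?exprn_ge0 ?ultranorm_ge0//.
  (* The bound A^(-2) suffices for the linear regime, because p zeta (j+1) = zeta j + 1 < 2 <=
     2(p-1). *)
  apply: (@le_trans _ _ (A^(-2) ^+ (p - 1))).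
    by rewrite lerXn2r ?nnegrE ?ultranorm_ge0 ?powR_ge0// (le_trans zD).
  rewrite vz !powR_gt1X// Ele pB.
  by have := @zeta_lt1 R p p2 j.+1; have := p11; lra.
split; first by rewrite (le_trans (ultranormD _ _ _))// ge_max s2 !le_max s1 lexx orbT.
move=> Dd j0; rewrite unD_eqr s2//; apply: le_lt_trans s1 _.
by move: Dd; rewrite j0 /= oppr0 E0 mul1r.
Qed.

(* Two points following the same block of zeros for two close parameters: the
   initial discrepancy D is contracted, and the discrepancy created at the last
   step of the block dominates. *)
Lemma shadow_block0 j z z' (D : R) : d <= -1 -> v z = A^(- zeta j.+1) ->
  v (z' - z) <= D -> D <= A^(-2) -> D * A^(Psi j.+1) < A^(d - 1) ->
  (forall i, (i < j.+1)%N -> v (iter i (F a') z') = v (iter i (F a) z)) /\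
  v (iter j.+1 (F a') z' - iter j.+1 (F a) z) = A^(d - 1).
Proof.
move=> d1; elim: j z z' D => [|j IH] z z' D vz zD D2 DS.
  have close : v (z' - z) < v z.
    apply: le_lt_trans zD _; apply: le_lt_trans D2 _; rewrite vz Elt.
    by rewrite ltrN2 (lt_trans (@zeta_lt1 R p p2 _))// ltr1n.
  split=> [[|i]// _|]; first by rewrite /= (un_eq_of_close v z z')// un_distC.
  have [_] := shadow_step0 z z' 0 D vz zD D2.
  move=> /= ->//; rewrite ?subr0//.
  by move: DS; rewrite /= subr0 E0 mulr1.
have zj0 := @zetaS_gt0 R p p2 j.
have [le_max' _] := shadow_step0 z z' j.+1 D vz zD D2.
have D0 : 0 <= D by apply: le_trans zD; exact: ultranorm_ge0.
have vFz : v (F a z) = A^(- zeta j.+1) by apply: step_sphere.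
(* The transported discrepancy satisfies the new hypothesis because [zeta_sum] records the
   contraction just made; the newly created one because [zeta_sum] is nonpositive. *)
have [||same last] := IH (F a z) (F a' z') (Num.max (A^(- zeta j.+1) * D) (A^(d - 1 - zeta j.+1))) vFz le_max'.
- rewrite ge_max Ele; apply/andP; split; last by lra.
  by apply: le_trans D2; rewrite ler_piMl// Ele1; lra.
- rewrite maxr_pMl ?powR_ge0// gt_max -ED Elt; apply/andP; split.
    have SE : Psi j.+2 = Psi j.+1 - zeta j.+1 by [].
    rewrite SE in DS; apply: le_lt_trans DS.
    by rewrite mulrAC -ED mulrC ler_wpM2l// Ele; lra.
  by have := @zeta_sum_le0 R p j.+1; lra.
split=> [[_|i ij]|]; last by rewrite 2!(iterSr j.+1).
  rewrite /= (un_eq_of_close v z z')// un_distC.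
  apply: le_lt_trans zD _; apply: le_lt_trans D2 _; rewrite vz Elt.
  by have := @zeta_lt1 R p p2 j.+2; lra.
by rewrite 2!(iterSr i) same.
Qed.

(** Each step multiplies the discrepancy by A. The contribution of the parameter at step i is at
    most A^(d + i - M), since the orbit is that close to 1, and this is less than A^(d + i). *)
Lemma shadow_block1 (M : nat) z z' : (0 < M)%N -> d <= 1 - M%:R ->
  v (z - 1) <= A^(- M%:R) -> v (z' - z) = A^(d - 1) -> forall i, (i <= M)%N ->
  v (iter i (F a') z' - iter i (F a) z) = A^(d - 1 + i%:R).
Proof.
move=> M0 dM zM zz; elim=> [|i IH] iM; first by rewrite addr0.
have IHi := IH (ltnW iM).
have iM' : i%:R + 1 <= M%:R :> R by rewrite natr1 ler_nat.
have zi : v (iter i (F a) z - 1) <= A^(i%:R - M%:R).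
  by apply: iter_near1 => //; lra.
have zi1 : v (iter i (F a) z - 1) < 1 by apply: le_lt_trans zi _; rewrite Elt1; lra.
rewrite !iterS; set w' := iter i _ z' in IHi *; set w := iter i _ z in IHi zi zi1 *.
rewrite -(subrKA (F a' w)).
have s1 : v (F a' w' - F a' w) = A^(d - 1 + i.+1%:R).
  rewrite (un_PaB1 v p) ?va'// IHi; last by rewrite Elt1; lra.
  rewrite -{1}E1 -ED; congr (_ `^ _); rewrite -natr1; lra.
rewrite unD_eq s1// Pa_map_paramB// da (un_near1 v w zi1) expr1n mul1r.
apply: le_lt_trans (ler_wpM2l (ltW (E_gt0 d)) zi) _; rewrite -ED Elt -natr1.
have : (1 : R) <= M%:R by rewrite ler1n.
have : (0 : R) <= i%:R by []. 
lra.
Qed.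

End Shadowing.
End Orbits.

(** * Choice of the parameter *)

Section Construction.
Context {R : realType} {K : closedFieldType} (v : ultranorm R K) (p : nat).
Hypotheses (p_prime : prime p) (vp : v p%:R < 1) (v_complete : complete_norm v).
Variables (m M : nat -> nat).
Hypotheses (m_gt0 : forall k, (0 < m k)%N) (M0_ge2 : (1 < M 0)%N).
Hypothesis M_incr : forall k, (M k + 2 <= M k.+1)%N.
Hypothesis mM : forall k, (M k)%:R + zeta_sum p (m k.+1) < 0 :> R.
Variable a0 : K.
Hypothesis a0_param : param_set v p a0.
Implicit Types (a z : K) (i j k n : nat).

Definition block_start (m M : nat -> nat) (k : nat) : nat := (\sum_(j < k) (m j + M j))%N.

Local Notation T := (block_start m M).
Local Notation A := (v a0).
Local Notation "A^ x" := (A `^ x) (at level 5, x at level 5).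
Local Notation zeta := (@zeta R p).
Local Notation Psi := (@zeta_sum R p).
Local Notation F a := (Pa_map p a).

Let p2 : (1 < p)%N. Proof. exact: prime_gt1. Qed.
Let A1 : 1 < A. Proof. by case: a0_param. Qed.
Let A0 : 0 < A. Proof. exact: lt_trans A1. Qed.
Let vpA : v p%:R ^+ (p - 1) <= (A)^-1. Proof. exact: (param_setE v p a0). Qed.
Let E0 : A^(0) = 1. Proof. exact: powRr0. Qed.
Let E_gt0 (x : R) : 0 < A^(x). Proof. exact: powR_gt0. Qed.
Let ED (x y : R) : A^(x + y) = A^(x) * A^(y). Proof. exact: powR_gt1D. Qed.
Let Elt (x y : R) : (A^(x) < A^(y)) = (x < y). Proof. exact: ltr_powR_gt1. Qed.
Let Ele (x y : R) : (A^(x) <= A^(y)) = (x <= y). Proof. exact: ler_powR_gt1. Qed.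
Let Elt1 (x : R) : (A^(x) < 1) = (x < 0). Proof. by rewrite -E0 Elt. Qed.
Let Ele1 (x : R) : (A^(x) <= 1) = (x <= 0). Proof. by rewrite -E0 Ele. Qed.

Lemma block_startS k : T k.+1 = (T k + m k + M k)%N.
Proof. by rewrite /block_start big_ord_recr /= addnA. Qed.

Let M_ge k : (k.*2 + 2 <= M k)%N.
Proof.
elim: k => [|k IH] //; apply: leq_trans (M_incr k).
by rewrite leq_add2r doubleS -addn2.
Qed.

Let M_gt0 k : (0 < M k)%N. Proof. by apply: leq_trans (M_ge k); rewrite addn2. Qed.

Let M_incrR k : (M k)%:R + 2 <= (M k.+1)%:R :> R.
Proof. by rewrite -[2]/(2%:R) -natrD ler_nat. Qed.

Let M_geR k : 2 <= (M k)%:R :> R.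
Proof. by rewrite -[2]/(2%:R) ler_nat (leq_trans _ (M_ge k))// leq_addl. Qed.

(** The number B = p^j zeta j is a natural number, so a p^j-th root of a0^(-B) has the required
    norm. *)
Lemma sphere_point j : exists z, v z = A^(- zeta j).
Proof.
have [B HB] : exists B : nat, p%:R ^+ j * zeta j = B%:R :> R.
  elim: j => [|j [B HB]] /=; first by exists 0%N; rewrite mulr0.
  exists (B + p ^ j)%N; rewrite natrD -HB natrX exprS.
  have : p%:R != 0 :> R by rewrite pnatr_eq0 -lt0n ltnW.
  by move=> h; field.
have N0 : (0 < p ^ j)%N by rewrite expn_gt0 ltnW.
have [z zE] := solve_monicpoly (fun i => if i == 0%N then a0 ^- B else 0) N0.
exists z; have {}zE : z ^+ (p ^ j) = a0 ^- B.
  rewrite zE -(prednK N0) big_ord_recl /= expr0 mulr1 big1 ?addr0// => i _.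
  by rewrite mul0r.
apply/eqP; rewrite -(@eqrXn2 _ (p ^ j)) ?ultranorm_ge0 ?powR_ge0//.
rewrite -unX zE unV unX powR_gt1X// natrX mulrN HB powRN powR_mulrn//.
exact: ultranorm_ge0.
Qed.

Lemma iter_poly a n : exists Q : {poly K}, forall z, Q.[z] = iter n (F a) z.
Proof.
elim: n => [|n [Q HQ]]; first by exists 'X => z; rewrite hornerX.
exists (Pa p a \Po Q) => z; by rewrite horner_comp HQ.
Qed.

Lemma iter_poly_param x n : exists Q : {poly K}, forall a, Q.[a] = iter n (F a) x.
Proof.
elim: n => [|n [Q HQ]]; first by exists x%:P => a; rewrite hornerC.
exists (Q ^+ p * ('X + (1 - 'X) * Q)) => a.
by rewrite iterS Pa_mapE !hornerE HQ.
Qed.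

Lemma iter_Pa0 a n : iter n (F a) 0 = 0.
Proof. by elim: n => // n IH; rewrite iterS IH Pa_map0. Qed.

Lemma iter_Pa1 a n : iter n (F a) 1 = 1.
Proof. by elim: n => // n IH; rewrite iterS IH Pa_map1. Qed.

(** A point w of the sphere is sent to the unit sphere while 0 is fixed, so the disk |z| <= |w|
    covers 1; [iter_in_sphere] excludes a preimage of smaller norm. *)
Lemma initial_point : exists2 x, v x = A^(- zeta (m 0)) & iter (m 0) (F a0) x = 1.
Proof.
have [w vw] := sphere_point (m 0).
have [Q HQ] := iter_poly a0 (m 0).
have vQw : v (Q.[w] - Q.[0]) = 1.
  by rewrite !HQ iter_Pa0 subr0 (iter_sphere v p A p_prime A1 a0 w (m 0) _ erefl) ?subnn//= oppr0.
have [|x xw Qx] := disk_surj_eval v Q 0 w 1.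
  by rewrite vQw HQ iter_Pa0 subr0 un1.
rewrite !subr0 vw in xw; rewrite HQ in Qx; exists x => //.
apply/le_anti; rewrite xw leNgt; apply/negP => lt_x.
have := iter_in_sphere v p A p_prime A1 a0 x (m 0) erefl lt_x.
by rewrite Qx un1 ltxx.
Qed.

Section Fixed_point.
Variable x : K.
Hypotheses (vx : v x = A^(- zeta (m 0))) (x1 : iter (m 0) (F a0) x = 1).

(** The blocks of zeros are controlled up to index k included, the blocks of ones only below k: the
    control stops at time [T k + m k]. *)
Definition good_orbit a k :=
  (forall j i, (j <= k)%N -> (i < m j)%N ->
     v (iter (T j + i) (F a) x) = A^(- zeta (m j - i))) /\
  (forall j i, (j < k)%N -> (i < M j)%N ->
     v (iter (T j + m j + i) (F a) x - 1) = A^(i%:R - (M j)%:R)).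

(** Each block of zeros ends with discrepancy exactly A^(d-1), whatever came before. The following
    block of ones expands it to A^(d - 1 + M_k), and by [mM] the next zeros contract this below the
    discrepancy created at their last step. *)
Lemma shadow_orbit a a' (d : R) k : v a = A -> v a' = A -> v (a' - a) = A^(d) ->
  d <= 1 - (M k)%:R -> good_orbit a k -> good_orbit a' k /\
  v (iter (T k + m k) (F a') x - iter (T k + m k) (F a) x) = A^(d - 1).
Proof.
move=> va va' da; elim: k => [|k IH] dk [g0 g1].
  have T0 : T 0 = 0%N by rewrite /block_start big_ord0.
  have := M_geR 0 => M2.
  have [|||||same last] := shadow_block0 v p A p_prime vp A1 vpA a a' d va va' da (m 0).-1 x x 0.
  - lra.
  - by rewrite prednK.
  - by rewrite subrr un0.
  - exact: powR_ge0.
  - by rewrite mul0r.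
  rewrite prednK// in same last; rewrite T0 add0n; split=> //; split=> // -[|j] i // _ im.
  by rewrite T0 add0n same// -(g0 0%N)// T0.
have [||gk' last] := IH.
- by have := M_incrR k; lra.
- by split=> [j i jk|j i jk]; [apply: g0; exact: leqW | apply: g1; exact: ltnW].
have := M_geR k => M2; have M3 := M_incrR k; have M4 := M_geR k.+1.
have zM : v (iter (T k + m k) (F a) x - 1) <= A^(- (M k)%:R).
  by have := g1 k 0%N (ltnSn k) (M_gt0 k); rewrite addn0 sub0r => ->.
have dM : d <= 1 - (M k)%:R by lra.
have blk1 := shadow_block1 v p A p_prime vp A1 a a' d va va' da (M k) _ _ (M_gt0 k) dM zM last.
have iterE b i : iter (T k + m k + i) (F b) x = iter i (F b) (iter (T k + m k) (F b) x).
  by rewrite addnC iterD.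
have g1k i : (i < M k)%N -> v (iter (T k + m k + i) (F a') x - 1) = A^(i%:R - (M k)%:R).
  move=> iM; rewrite -(g1 k i (ltnSn k) iM) -(subrKA (iter (T k + m k + i) (F a) x)).
  rewrite [LHS]unD_eqr// (g1 k i (ltnSn k) iM) !iterE blk1 ?(ltnW iM)// Elt.
  by lra.
have TS b i : iter (T k.+1 + i) (F b) x = iter i (F b) (iter (M k) (F b) (iter (T k + m k) (F b) x)).
  by rewrite block_startS addnC iterD -iterE.
set z := iter (M k) (F a) (iter (T k + m k) (F a) x) in TS.
have vz : v z = A^(- zeta (m k.+1).-1.+1).
  by rewrite prednK// -(subn0 (m k.+1)) -g0// TS.
have [|||||same lst] := shadow_block0 v p A p_prime vp A1 vpA a a' d va va' da (m k.+1).-1 z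
  (iter (M k) (F a') (iter (T k + m k) (F a') x)) (A^(d - 1 + (M k)%:R)).
- lra.
- by [].
- by rewrite blk1.
- by rewrite Ele; lra.
- by rewrite -ED Elt prednK//; have := mM k; lra.
rewrite prednK// in same lst.
split; last by rewrite !TS.
case: gk' => h0 h1; split=> [j i|j i].
  rewrite leq_eqVlt => /predU1P[->|jk] im; last exact: h0.
  by rewrite TS same// -g0// TS.
rewrite ltnS leq_eqVlt => /predU1P[->|jk] im; last exact: h1.
exact: g1k.
Qed.

Lemma shadow_orbit_end a a' (d : R) k i : v a = A -> v a' = A -> v (a' - a) = A^(d) ->
  d <= 1 - (M k)%:R -> good_orbit a k ->
  v (iter (T k + m k) (F a) x - 1) <= A^(- (M k)%:R) -> (i <= M k)%N ->
  v (iter (T k + m k + i) (F a') x - iter (T k + m k + i) (F a) x) = A^(d - 1 + i%:R).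
Proof.
move=> va va' da dk ga zM iM; have [_ last] := shadow_orbit a a' d k va va' da dk ga.
rewrite (addnC (T k + m k)%N) !(iterD i).
exact: (shadow_block1 v p A p_prime vp A1 a a' d va va' da (M k)).
Qed.

Definition stage k a :=
  [/\ v a = A, good_orbit a k & iter (T k + m k) (F a) x = 1].

Lemma stage0 : stage 0 a0.
Proof.
have T0 : T 0 = 0%N by rewrite /block_start big_ord0.
split=> //; last by rewrite T0.
split=> // -[|j] i // _ im; rewrite T0 add0n.
by rewrite (iter_sphere v p A p_prime A1 a0 x (m 0) _ erefl)// ltnW.
Qed.

Lemma un_close_eqA b (d : R) a : v a = A -> d <= 0 -> v (b - a) <= A^(d) -> v b = A.
Proof.
move=> va d0 ba; rewrite (un_eq_of_close v a b) ?va// un_distC.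
by apply: le_lt_trans ba _; apply: le_lt_trans A1; rewrite Ele1.
Qed.

(* On the disk |b - a| <= A^(1 - M_k) the iterate of x of order T k.+1 is a
   similarity in the parameter b, onto the closed unit disk; the parameter is
   first moved to one sending x to 0, from which 1 is reached m_(k+1) steps later
   by surjectivity of polynomials on disks. *)
Lemma stage_step k a : stage k a ->
  exists2 b, stage k.+1 b & v (b - a) = A^(1 - (M k)%:R).
Proof.
case=> va ga Fa; set e : R := 1 - (M k)%:R; have M2 := M_geR k.
have Ma i : iter (T k + m k + i) (F a) x = 1.
  by rewrite (addnC (T k + m k)%N) iterD Fa iter_Pa1.
have expo b c : b != c -> v (b - a) <= A^(e) -> v (c - a) <= A^(e) ->
    exists2 d, v (b - c) = A^(d) & d <= e.
  move=> bc ba ca; have bc0 : 0 < v (b - c) by rewrite un_gt0 subr_eq0.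
  have [d dE] := powR_gt1_onto A A1 _ bc0; exists d => //.
  by rewrite -Ele -dE -(subrKA a) unD_le// un_distC.
have inA b : v (b - a) <= A^(e) -> v b = A.
  by apply: un_close_eqA => //; rewrite /e; lra.
have e0 : v (a - a) <= A^(e) by rewrite subrr un0 powR_ge0.
have near b : v (b - a) <= A^(e) -> good_orbit b k /\
    v (iter (T k + m k) (F b) x - 1) <= A^(- (M k)%:R).
  move=> be; have [->|ba] := eqVneq b a; first by rewrite Fa subrr un0 powR_ge0.
  have [d dE de] := expo b a ba be e0.
  have [gb] := shadow_orbit a b d k va (inA b be) dE de ga.
  by rewrite Fa => ->; split=> //; rewrite Ele; move: de; rewrite /e; lra.
have scal b c i : v (b - a) <= A^(e) -> v (c - a) <= A^(e) -> (i <= M k)%N ->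
    v (iter (T k + m k + i) (F b) x - iter (T k + m k + i) (F c) x) =
    v (b - c) * A^(i%:R - 1).
  move=> be ce iM; have [->|bc] := eqVneq b c; first by rewrite !subrr un0 mul0r.
  have [d dE de] := expo b c bc be ce; have [gc zc] := near c ce.
  rewrite dE -ED (shadow_orbit_end c b d k i (inA c ce) (inA b be) dE de gc zc iM).
  by congr (_ `^ _); lra.
have TM : (T k + m k + M k)%N = T k.+1 by rewrite block_startS.
have scalM b c : v (b - a) <= A^(e) -> v (c - a) <= A^(e) ->
    v (iter (T k.+1) (F b) x - iter (T k.+1) (F c) x) = v (b - c) * A^((M k)%:R - 1).
  by move=> be ce; rewrite -TM scal.
have Ta : iter (T k.+1) (F a) x = 1 by rewrite -TM Ma.
have [Q HQ] := iter_poly_param x (T k.+1).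
have [Q' HQ'] := iter_poly_param x (T k.+1 + m k.+1).
have eM : A^(e) * A^((M k)%:R - 1) = 1 by rewrite -ED (_ : e + _ = 0) ?E0// /e; lra.
(* A parameter at the extreme distance A^(1 - M_k) from a: its image is at distance exactly 1 from
   the image 1 of a, so the images of the parameter disk cover 0. *)
pose b1 := a + a0 ^- (M k - 1).
have b1e : v (b1 - a) = A^(e).
  rewrite /b1 addrC addKr unV unX -powR_mulrn ?ultranorm_ge0// -powRN.
  by congr (_ `^ _); rewrite natrB ?M_gt0 ?/e//; lra.
have [|c ce Qc] := disk_surj_eval v Q a b1 0.
  by rewrite !HQ scalM ?b1e// eM Ta sub0r unN un1.
rewrite b1e in ce; rewrite HQ in Qc.
have [w vw] := sphere_point (m k.+1).
(* With c' the point lands on the sphere of w, so after [m k.+1] more steps the images for c and c'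
   differ by norm 1. *)
have [|c' c'c Qc'] := disk_surj_eval v Q c a w.
  by rewrite !HQ Qc Ta !subr0 vw un1 Ele1 oppr_le0 zeta_ge0.
have c'e : v (c' - a) <= A^(e).
  by rewrite -(subrKA c) unD_le// (le_trans c'c)// un_distC.
rewrite HQ in Qc'.
have Fblock u j : iter (T k.+1 + j) (F u) x = iter j (F u) (iter (T k.+1) (F u) x).
  by rewrite addnC iterD.
have [|b bc Qb] := disk_surj_eval v Q' c c' 1.
  rewrite !HQ' !Fblock Qc Qc' iter_Pa0 !subr0 un1.
  by rewrite (iter_sphere v p A p_prime A1 c' w (m k.+1) _ (inA _ c'e) vw)// subnn oppr0 powRr0.
rewrite HQ' Fblock in Qb.
have be : v (b - a) <= A^(e).
  by rewrite -(subrKA c) unD_le// (le_trans bc)// -(subrKA a) unD_le// un_distC.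
have vb := inA b be.
have vTb : v (iter (T k.+1) (F b) x) = A^(- zeta (m k.+1)).
  apply/le_anti/andP; split.
    rewrite -vw -Qc' -(subr0 (iter _ (F b) x)) -(subr0 (iter _ (F c') x)) -Qc.
    by rewrite !scalM// ler_wpM2r ?powR_ge0.
  rewrite leNgt; apply/negP => lt_b.
  have := iter_in_sphere v p A p_prime A1 b _ (m k.+1) vb lt_b.
  by rewrite Qb un1 ltxx.
have ba : v (b - a) = A^(e).
  apply: (@mulIf _ A^((M k)%:R - 1)); first by rewrite gt_eqF.
  rewrite eM -scalM// Ta unD_eqr unN un1// vTb Elt1 oppr_lt0.
  by rewrite -(prednK (m_gt0 k.+1)) zetaS_gt0.
have [gb zb] := near b be.
exists b => //; split=> //; last by rewrite Fblock.
case: gb => g0 g1; split=> [j i|j i].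
  rewrite leq_eqVlt => /predU1P[->|jk] im; last exact: g0.
  by rewrite Fblock (iter_sphere v p A p_prime A1 b _ (m k.+1) _ vb vTb)// ltnW.
rewrite ltnS leq_eqVlt => /predU1P[->|jk] im; last exact: g1.
have <- := Ma i; rewrite scal// ?ba -?ED; last exact: ltnW.
by congr (_ `^ _); rewrite /e; lra.
Qed.

(** The successive moves A^(1 - M_k) strictly decrease to 0, so the limit is at distance exactly
    A^(1 - M_k) from stage k. This is the largest perturbation that [shadow_orbit] admits, so the
    limit inherits the orbit of every stage. *)
Lemma limit_parameter : exists2 a, v (a - a0) = A^(1 - (M 0)%:R) &
  v a = A /\ forall k, good_orbit a k.
Proof.
have step (k : nat) (a : {a | stage k a}) :
    {b : {b | stage k.+1 b} | v (sval b - sval a) = A^(1 - (M k)%:R)}.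
  have [b bs ba] := cid2 (stage_step k (sval a) (svalP a)).
  by exists (exist _ b bs).
pose u := fix u k : {a | stage k a} :=
  if k is j.+1 then sval (step j (u j)) else exist _ a0 stage0.
have uS k : v (sval (u k.+1) - sval (u k)) = A^(1 - (M k)%:R) := svalP (step k (u k)).
have M_leR j i : (M j)%:R <= (M (j + i))%:R :> R.
  elim: i => [|i IH]; rewrite ?addn0// addnS (le_trans IH)//.
  by rewrite ler_nat (leq_trans _ (M_incr _))// leq_addr.
have uD k i : v (sval (u (k + i)%N) - sval (u k)) <= A^(1 - (M k)%:R).
  elim: i => [|i IH]; first by rewrite addn0 subrr un0 powR_ge0.
  rewrite addnS -(subrKA (sval (u (k + i)%N))) unD_le// uS Ele.
  by have := M_leR k i; lra.
have [e e0|a ua] := v_complete (fun k => sval (u k)).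
  have [n hn] := exprn_unbounded A A1 e^-1.
  have An : A^(1 - (M n)%:R) < e.
    rewrite -ltf_pV2 ?posrE// -powRN; apply: lt_le_trans hn _.
    rewrite -powR_mulrn ?Ele; last exact: ltW.
    have : (n + 1)%:R <= (M n)%:R :> R.
      by rewrite ler_nat (leq_trans _ (M_ge n))// -muln2; lia.
    by rewrite natrD; lra.
  exists n => i j ni nj; apply: le_lt_trans An.
  rewrite -(subrKA (sval (u n))) -(subnKC ni) -(subnKC nj) unD_le ?uD//.
  by rewrite un_distC uD.
have near_a k : v (a - sval (u k)) = A^(1 - (M k)%:R).
  have /cvgrPdist_lt/(_ _ (E_gt0 (1 - (M k)%:R)))[N _ HN] := ua.
  have := HN (N + k.+1)%N (leq_addr _ _); rewrite sub0r normrN ger0_norm ?ultranorm_ge0// => aN.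
  rewrite un_distC (addnC N) in aN.
  have unk : v (sval (u (k.+1 + N)%N) - sval (u k)) = A^(1 - (M k)%:R).
    rewrite -(subrKA (sval (u k.+1))) [LHS]unD_eqr uS//.
    by apply: le_lt_trans (uD _ _) _; rewrite Elt; have := M_incrR k; lra.
  by rewrite -(subrKA (sval (u (k.+1 + N)%N))) [LHS]unD_eqr unk.
have va : v a = A.
  by apply: (un_close_eqA _ (1 - (M 0)%:R) a0 erefl); [have := M_geR 0; lra | rewrite (near_a 0%N)].
exists a; first exact: (near_a 0%N).
split=> // k; have [vu gu _] := svalP (u k).
by have [||] := shadow_orbit (sval (u k)) a _ k vu va (near_a k).
Qed.

End Fixed_point.

Lemma wandering_orbit_exists : exists a x, [/\ v a = v a0,
  v (a - a0) = v a0 ^- (M 0 - 1) & forall k,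
  (forall i, (i < m k)%N ->
     v (iter (T k + i) (F a) x) = v a `^ (- zeta (m k - i))) /\
  (forall i, (i < M k)%N ->
     v (iter (T k + m k + i) (F a) x - 1) = v a `^ (i%:R - (M k)%:R))].
Proof.
have [x vx x1] := initial_point; have [a aa0 [va ga]] := limit_parameter x vx x1.
exists a, x; rewrite va; split=> // [|k].
  rewrite aa0 -powR_mulrn ?ultranorm_ge0// -powRN; congr (_ `^ _).
  by rewrite natrB ?(ltnW M0_ge2)//; lra.
split=> i im; first by have [+ _] := ga k; apply.
by have [_] := ga k.+1; apply.
Qed.

End Construction.

(** * Itineraries *)

Section Words.
Variables m M : nat -> nat.
Hypothesis m_gt0 : forall k, (0 < m k)%N.
Local Notation T := (block_start m M).
Local Notation theta := (block_word m M).

Lemma block_start_ge k : (k <= T k)%N.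
Proof.
elim: k => // k IH; rewrite block_startS -addnA; have := m_gt0 k; lia.
Qed.

Lemma block_wordE k i : (i < m k + M k)%N -> theta (T k + i) = (m k <= i)%N.
Proof.
move=> ik; rewrite /block_word; set n := (T k + i)%N.
set f := fun j => nseq (m j) false ++ nseq (M j) true.
have szf k' : size (flatten [seq f j | j <- iota 0 k']) = T k'.
  elim: k' => [|k' IH]; first by rewrite /block_start big_ord0.
  rewrite -addn1 iotaD map_cat flatten_cat size_cat IH /= cats0 addn1 block_startS.
  by rewrite size_cat !size_nseq addnA.
have kn : (k <= n)%N by apply: leq_trans (block_start_ge k) (leq_addr _ _).
have -> : n.+1 = (k + (n - k).+1)%N by rewrite addnS subnKC.
rewrite iotaD map_cat flatten_cat nth_cat szf ltnNge leq_addr /= addKn.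
rewrite -catA !nth_cat !size_nseq !nth_nseq; case: ltnP => // mi.
by rewrite ltn_subLR// ik.
Qed.

Lemma block_decomp n : exists k i, n = (T k + i)%N /\ (i < m k + M k)%N.
Proof.
elim: n => [|n [k [i [-> ik]]]].
  by exists 0%N, 0%N; rewrite /block_start big_ord0 addn_gt0 m_gt0.
have [lt_ik|le_ki] := ltnP i.+1 (m k + M k); first by exists k, i.+1; rewrite addnS.
exists k.+1, 0%N; split; last by rewrite addn_gt0 m_gt0.
rewrite addn0 block_startS -addnS -addnA; congr (_ + _)%N.
by apply/eqP; rewrite eqn_leq ik.
Qed.

Hypothesis M_ge : forall k, (k <= M k)%N.

(** For i < j, shift so that j reaches the end of a block of ones longer than j - i: there a zero
    begins, while the shift of i still lies among the ones. *)
Lemma block_word_aperiodic i j : i != j -> exists n, theta (i + n) != theta (j + n).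
Proof.
wlog ij : i j / (i < j)%N.
  move=> H ij; have [lt|lt|eq] := ltngtP i j; [exact: H| |by rewrite eq eqxx in ij].
  by have [|n] := H j i lt; [rewrite eq_sym|exists n; rewrite eq_sym].
move=> _; pose k := (i + j)%N; exists (T k.+1 - j)%N.
have jT : (j <= T k.+1)%N.
  by apply: leq_trans (block_start_ge _); rewrite /k; lia.
rewrite subnKC//; have TS := block_startS m M k; have Tk := block_start_ge k; have Mk := M_ge k.
have -> : theta (T k.+1) = false.
  by rewrite -(addn0 (T k.+1)) block_wordE ?addn_gt0 ?m_gt0// leqNgt m_gt0.
have -> : (i + (T k.+1 - j))%N = (T k + (m k + M k - (j - i)))%N.
  by rewrite /k in TS Tk Mk *; lia.
by rewrite block_wordE /k; rewrite /k in Mk; lia.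
Qed.

End Words.

Lemma itinerary_wandering {T : Type} (f : T -> T) (theta : nat -> bool) (B B0 B1 : set T) :
  B0 `&` B1 = set0 ->
  (forall x n, B x -> if theta n then B1 (iter n f x) else B0 (iter n f x)) ->
  (forall i j, i != j -> exists n, theta (i + n)%N != theta (j + n)%N) ->
  wandering f B.
Proof.
move=> B01 it aper i j ij; apply/seteqP; split=> // _ [[x Bx <-] [y By xy]].
have [n] := aper i j ij.
have := it x (i + n)%N Bx; have := it y (j + n)%N By.
rewrite !(addnC _ n) !iterD xy; set w := iter n f _.
have no : ~ (B0 w /\ B1 w) by move=> h; have : (B0 `&` B1) w by []; rewrite B01.
by case: (theta _); case: (theta _) => // h0 h1; exfalso; apply: no.
Qed.

(** * Radii along the orbit *)

(* rho n is the exponent of the radius of the n-th image of a disk of radius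
   A^t around an orbit with itinerary theta lying at distance A^(- e n) from 0
   when it is in B(0). *)
Fixpoint rho {R : realType} (p : nat) (theta : nat -> bool) (e : nat -> R) (t : R) (n : nat) : R :=
  if n is n'.+1 then
    let r := rho p theta e t n' in
    1 + (if theta n' then r else Num.max (p%:R * r) (r - p%:R * e n'))
  else t.

Section Radius.
Context {R : realType} (p : nat).
Hypothesis p2 : (1 < p)%N.
Variables (m M : nat -> nat) (e : nat -> R).
Hypothesis m_ge2 : forall k, (1 < m k)%N.
Local Notation T := (block_start m M).
Local Notation zeta := (@zeta R p).
Local Notation Psi := (@zeta_sum R p).
Local Notation P := (p%:R : R).
Hypothesis eE : forall k i, (i < m k)%N -> e (T k + i)%N = zeta (m k - i).
Local Notation rh := (rho p (block_word m M) e).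
Implicit Types (t : R) (i j k n : nat).

Let m_gt0 k : (0 < m k)%N. Proof. exact: ltnW. Qed.
Let P2 : 2 <= P. Proof. by rewrite -[2]/(2%:R) ler_nat. Qed.

(** The excess over - p / (p-1)^2 at which the linear and nonlinear terms agree in the first step of
    block k. *)
Definition threshold (k : nat) : R := P / (P - 1) ^+ 2 / P ^+ m k.

(** The change M_k + [zeta_sum] (m_k) of the exponent over an entirely linear block k is this drift
    minus the threshold. *)
Definition drift (k : nat) : R := (M k)%:R - (m k)%:R / (P - 1) + P / (P - 1) ^+ 2.

Lemma rho_zero t k i : (i < m k)%N ->
  rh t (T k + i).+1 = Num.max (1 + P * rh t (T k + i)) (rh t (T k + i) - zeta (m k - i).-1).
Proof.
move=> im; rewrite /= block_wordE ?(leq_trans im (leq_addr _ _))// leqNgt im /= eE//.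
rewrite addr_maxr; congr (Num.max _ _).
have := @zeta_rec R p p2 (m k - i).-1; rewrite prednK ?subn_gt0// => ->; lra.
Qed.

Lemma rho_one t k i : (i <= M k)%N -> rh t (T k + m k + i) = rh t (T k + m k) + i%:R.
Proof.
elim: i => [|i IH] iM; first by rewrite addn0 addr0.
rewrite addnS /= -addnA block_wordE ?ltn_add2l// leq_addr addnA IH ?(ltnW iM)// -natr1.
lra.
Qed.

Lemma Psi_closed j : Psi j = - j%:R / (P - 1) + P / (P - 1) ^+ 2 * (1 - (P ^+ j)^-1).
Proof.
have P1 : P - 1 != 0 by rewrite gt_eqF// subr_gt0 ltr1n.
apply: (mulfI P1); rewrite zeta_sum_closed//; field.
by rewrite P1 expf_neq0// gt_eqF// ltr0n ltnW.
Qed.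

(* Only the first step of a block of zeros can be nonlinear. *)
Lemma rho_block t k (sg : R) : rh t (T k) = - (P / (P - 1) ^+ 2) + sg ->
  P * (P - 1) * sg <= 1 ->
  rh t (T k.+1) = - (P / (P - 1) ^+ 2) +
    (sg + drift k - threshold k + Num.max 0 ((P - 1) * (sg - threshold k))).
Proof.
set h := P / (P - 1) ^+ 2 => r0 sg1; have Pge := P2.
have P1 : P - 1 != 0 by rewrite gt_eqF// subr_gt0 ltr1n.
have P0 : P != 0 by rewrite pnatr_eq0 -lt0n ltnW.
have hP : h * (P - 1) ^+ 2 = P by rewrite /h divfK// expf_neq0.
have hP1 : (P - 1) * h = 1 + (P - 1)^-1 by rewrite /h; field.
have iP : (P - 1) * (P - 1)^-1 = 1 by rewrite divff.
have iP0 : 0 < (P - 1)^-1.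
  by rewrite invr_gt0; lra.
have first := rho_zero t k 0 (m_gt0 k).
rewrite addn0 subn0 r0 in first.
have mk : (m k).-1 = (m k).-2.+1 by have := m_ge2 k; case: (m k) => [|[]].
have zm : P^-1 <= zeta (m k).-1.
  by rewrite mk /= ler_pdivlMr ?mulVf ?lerDr ?zeta_ge0// lt_neqAle eq_sym P0 ler0n.
have Psm : Psi (m k) = Psi (m k).-1 - zeta (m k).-1.
  by rewrite -{1}(prednK (m_gt0 k)).
have Pzm : P * zeta (m k) = zeta (m k).-1 + 1.
  by rewrite -{1}(prednK (m_gt0 k)) zeta_rec.
(* Below - h the linear term remains the larger one for the rest of the zeros, so it is enough to
   get there in one step. *)
have le_h : rh t (T k).+1 <= - h.
  rewrite first ge_max; apply/andP; split.
    have : P * sg <= (P - 1)^-1 by rewrite -(ler_pM2l (_ : 0 < P - 1)) ?iP; lra.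
    lra.
  suff : sg <= P^-1 by lra.
  have Pgt0 : 0 < P by lra.
  rewrite -(ler_pM2l Pgt0) divff//.
  have [sg0|sg0] := lerP sg 0; first by nra.
  apply: le_trans sg1; rewrite mulrAC ler_peMr ?mulr_ge0//; lra.
(* In the linear regime the exponent plus the contraction still to come is invariant. *)
have lin i : (i.+1 <= m k)%N -> rh t (T k + i.+1) + Psi (m k - i.+1) = rh t (T k).+1 + Psi (m k).-1
     /\ rh t (T k + i.+1) <= - h.
  elim: i => [|i IH] im; first by rewrite addn1 subn1.
  have [IH1 IH2] := IH (ltnW im).
  have step : rh t (T k + i.+2) = rh t (T k + i.+1) - zeta (m k - i.+1).-1.
    rewrite addnS rho_zero//; apply: max_r.
    have := @zeta_lt R p p2 (m k - i.+1); have := @zeta_rec R p p2 (m k - i.+1).-1.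
    rewrite prednK ?subn_gt0//.
    move: IH2; set r := rh _ _; set z := zeta (m k - i.+1); set z' := zeta _.
    move=> rh' zz zlt.
    have : (P - 1) * r <= - (P * z); last by lra.
    have : (P - 1) * r <= - ((P - 1) * h) by rewrite -mulrN ler_wpM2l//; lra.
    suff : P * z <= (P - 1) * h by lra.
    rewrite hP1 -(ler_pM2l (_ : 0 < P - 1)); last by lra.
    nra.
  have -> : (m k - i.+2)%N = (m k - i.+1).-1 by rewrite subnS.
  have z0 := @zeta_ge0 R p (m k - i.+1).-1.
  rewrite step; split; last by lra.
  rewrite -IH1; have -> : Psi (m k - i.+1) = Psi (m k - i.+1).-1 - zeta (m k - i.+1).-1.
    by rewrite -{1}(prednK (_ : 0 < m k - i.+1)%N)// subn_gt0.
  lra.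
have := lin (m k).-1; rewrite prednK ?m_gt0// subnn leqnn => /(_ isT)[+ _] /=.
rewrite addr0 => end0.
rewrite block_startS rho_one// end0 first.
have -> : threshold k = h / P ^+ m k by [].
have := Psi_closed (m k); rewrite -/h => PsE.
have -> : drift k = (M k)%:R - (m k)%:R / (P - 1) + h by [].
have Pm0 : P ^+ m k != 0 by rewrite expf_neq0.
have thr : (P - 1) * (sg - h / P ^+ m k) = 1 + P * (- h + sg) - (- h + sg - zeta (m k).-1).
  have := @zeta_closed R p p2 (m k).
  move=> zc.
  have : (P - 1) * (P * zeta (m k)) = P * (1 - (P ^+ m k)^-1) by rewrite mulrCA zc.
  rewrite Pzm => zc'.
  have : zeta (m k).-1 + 1 = (P - 1) * h * (1 - (P ^+ m k)^-1).
    apply: (mulfI P1); rewrite zc' -{1}hP; ring.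
  move=> zE; transitivity (zeta (m k).-1 + 1 + (P - 1) * (- h + sg)); last by ring.
  by rewrite zE; ring.
rewrite thr.
set a1 := 1 + _; set a2 := _ - zeta _.
have -> : Num.max a1 a2 = a2 + Num.max 0 (a1 - a2) by rewrite addr_maxr addr0 subrKC maxC.
have : a2 + Psi (m k).-1 = - h + sg + Psi (m k) by rewrite /a2 Psm; lra.
rewrite PsE => E; move: E; set mx := Num.max _ _.
lra.
Qed.

Lemma rho_inside t k : rh t (T k) < - zeta (m k) ->
  (forall i, (i <= m k)%N -> rh t (T k + i) < - zeta (m k - i)).
Proof.
move=> r0; elim=> [|i IH] im; first by rewrite addn0 subn0.
have := IH (ltnW im); rewrite addnS rho_zero// => ri.
have := @zeta_rec R p p2 (m k - i).-1; have z0 := @zeta_ge0 R p (m k - i).-1.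
rewrite prednK ?subn_gt0// subnS gt_max => zz; have Pge := P2; apply/andP; split; last first.
  have := @zetaS_gt0 R p p2 (m k - i).-1; rewrite prednK ?subn_gt0//; lra.
have : P * rh t (T k + i) < P * - zeta (m k - i) by rewrite ltr_pM2l//; lra.
lra.
Qed.

Lemma rho_zero_bounds t : (forall k, rh t (T k) < - zeta (m k)) -> forall k,
  (forall i, (i < m k)%N -> rh t (T k + i) < - zeta (m k - i)) /\
  (forall i, (i < M k)%N -> rh t (T k + m k + i) < 0).
Proof.
move=> r0 k; split=> [i im|i iM]; first exact: rho_inside (ltnW im).
have := r0 k.+1; rewrite block_startS !rho_one// ?(ltnW iM)// => lt0.
have z0 := @zeta_ge0 R p (m k.+1).
have : i%:R <= (M k)%:R :> R by rewrite ler_nat ltnW.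
lra.
Qed.

(** Each step is a piecewise affine function of the exponent with slopes 1 and p, so it never brings
    two exponents closer. *)
Lemma rho_diff_le t t' n : t <= t' -> rh t n <= rh t' n /\
  rh t' n - rh t n <= rh t' n.+1 - rh t n.+1.
Proof.
move=> tt; have Pge := P2.
have grow i : rh t i <= rh t' i -> rh t' i - rh t i <= rh t' i.+1 - rh t i.+1.
  move=> le_i /=; case: (block_word _ _ i); first by lra.
  set r := rh t i in le_i *; set r' := rh t' i in le_i *.
  suff : Num.max (P * r) (r - P * e i) <= Num.max (P * r') (r' - P * e i) - (r' - r) by lra.
  have : P * (r' - r) >= r' - r by rewrite ler_peMl; lra.
  move=> Pr; rewrite ge_max -[_ - (r' - r)]addrC addr_maxr !le_max.
  by apply/andP; split; apply/orP; [left|right]; lra.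
have le_rho : rh t n <= rh t' n by elim: n => // n IH; have := grow n IH; lra.
by split=> //; exact: grow.
Qed.

Lemma rho_diff_mono t t' i n : t <= t' -> (i <= n)%N ->
  rh t' i - rh t i <= rh t' n - rh t n.
Proof.
move=> tt; elim: n => [|n IH]; first by rewrite leqn0 => /eqP ->.
rewrite leq_eqVlt => /predU1P[->//|/IH h]; apply: le_trans h _.
by have [] := rho_diff_le t t' n tt.
Qed.

Lemma rho_diff_mul t t' k : t <= t' -> - (P / (P - 1) ^+ 2) + threshold k <= rh t (T k) ->
  P * (rh t' (T k) - rh t (T k)) <= rh t' (T k).+1 - rh t (T k).+1.
Proof.
move=> tt; have Pge := P2; have [le_r _] := rho_diff_le t t' (T k) tt.
have := rho_zero t k 0 (m_gt0 k); have := rho_zero t' k 0 (m_gt0 k).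
rewrite addn0 subn0 => -> ->; set r := rh t _ in le_r *; set r' := rh t' _ in le_r *.
rewrite /threshold; set h := P / (P - 1) ^+ 2 => thr.
have P1 : P - 1 != 0 by rewrite gt_eqF//; lra.
have hP : h * (P - 1) ^+ 2 = P by rewrite /h divfK// expf_neq0.
have zE : (P - 1) * h * (1 - (P ^+ m k)^-1) = zeta (m k).-1 + 1.
  have := @zeta_closed R p p2 (m k); have := @zeta_rec R p p2 (m k).-1.
  rewrite prednK// => zr zc; apply: (mulfI P1); rewrite -zr [RHS]mulrCA zc -[X in _ = X * _]hP; ring.
have : (P - 1) * (- h + h / P ^+ m k) <= (P - 1) * r by rewrite ler_wpM2l//; lra.
have -> : (P - 1) * (- h + h / P ^+ m k) = - (zeta (m k).-1 + 1) by rewrite -zE; ring.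
move=> le2; have E : Num.max (1 + P * r) (r - zeta (m k).-1) = 1 + P * r.
  by apply: max_l; lra.
rewrite E; apply: (@le_trans _ _ (1 + P * r' - (1 + P * r))); first by lra.
by rewrite lerD2r le_max lexx.
Qed.

End Radius.

(** * The exponent t *)

Section Sequences.
Context (p : nat) (l s : nat -> nat).
Hypotheses (p2 : (1 < p)%N) (l0 : l 0%N = 0%N) (l_incr : forall i, (l i < l i.+1)%N).
Hypothesis s_spec : forall k : nat,
     ((l (s k))%:Z * (p%:Z - 1) ^+ 2 - 1 <= k%:Z) /\
     (k%:Z < (l (s k).+1)%:Z * (p%:Z - 1) ^+ 2 - 1).
Local Notation m := (m_seq p l s).
Local Notation M := (M_seq p l s).
Implicit Types (i j k : nat).

(* The indices of the blocks at which the radius is at the threshold of the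
   nonlinear regime. *)
Definition special (i : nat) : nat := (l i * (p - 1) ^ 2)%N.

(** With this shift of index, m_k depends on [lprev k] and M_k on [lprev k.+1], and [lprev] equals
    [l i] from block [special i] until just before block [special i.+1]. *)
Definition lprev (k : nat) : nat := if k is k'.+1 then l (s k') else 0%N.

Lemma special0 : special 0 = 0%N. Proof. by rewrite /special l0. Qed.

Lemma special_incr i : (special i < special i.+1)%N.
Proof. by rewrite /special ltn_mul2r expn_gt0 subn_gt0 p2 l_incr. Qed.

Lemma special_mono i j : (i <= j)%N -> (special i <= special j)%N.
Proof.
elim: j => [|j IH]; first by rewrite leqn0 => /eqP ->.
by rewrite leq_eqVlt => /predU1P[->//|/IH h]; apply: leq_trans h (ltnW (special_incr j)).
Qed.

Lemma s_special k : (special (s k) <= k.+1 < special (s k).+1)%N.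
Proof.
have [h1 h2] := s_spec k; rewrite /special.
have pZ : (p%:Z - 1) = (p - 1)%N%:Z by rewrite subzn// ltnW.
have sq : (p%:Z - 1) ^+ 2 = ((p - 1) ^ 2)%N%:Z by rewrite pZ expr2 -PoszM mulnn.
rewrite sq -!PoszM in h1 h2; move: h1 h2; set u := (_ * _)%N; set w := (_ * _)%N; lia.
Qed.

Lemma lprev_special i k : (special i <= k < special i.+1)%N -> lprev k = l i.
Proof.
case: k => [|k] /andP[h1 h2] /=.
  case: i h1 h2 => [|i] h1 _; first by rewrite l0.
  by have := special_incr i; lia.
have /andP[g1 g2] := s_special k.
have [|si|->//] := ltngtP (s k) i.
  by move=> /special_mono; lia.
by have := special_mono _ _ si; lia.
Qed.

Lemma lprev_mono k : (lprev k <= lprev k.+1)%N.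
Proof.
case: k => [|k] //=; have /andP[g1 g2] := s_special k; have /andP[h1 h2] := s_special k.+1.
have [ss|] := leqP (s k) (s k.+1).
  elim: (s k.+1) ss => [|j IH]; first by rewrite leqn0 => /eqP ->.
  by rewrite leq_eqVlt => /predU1P[->//|/IH h]; apply: leq_trans h (ltnW (l_incr j)).
by move=> /special_mono; lia.
Qed.

Lemma M_seqE k : M k = (2 * k.+1 + (2 * p - 3) * lprev k.+1)%N.
Proof. by rewrite /M_seq /= mulnS (addnC 2%N). Qed.

Lemma m_seqE k : m k = ((p - 1) * (2 * k + (2 * p - 3) * lprev k) + 2 * p + 1)%N.
Proof. by case: k => [|k]; rewrite /m_seq ?M_seqE//= !muln0. Qed.

Lemma m_ge2 k : (1 < m k)%N. Proof. by rewrite m_seqE addn1 ltnS addn_gt0 !muln_gt0 (ltnW p2) orbT. Qed.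

Lemma M_seq_incr k : (M k + 2 <= M k.+1)%N.
Proof.
rewrite !M_seqE; have := leq_mul (leqnn (2 * p - 3)) (lprev_mono k.+1).
set w := (_ * lprev _)%N; set w' := (_ * lprev _)%N; lia.
Qed.

End Sequences.

Section Exponent.
Context (R : realType) (p : nat) (l s : nat -> nat).
Hypotheses (p2 : (1 < p)%N) (l0 : l 0%N = 0%N) (l_incr : forall i, (l i < l i.+1)%N).
Hypothesis s_spec : forall k : nat,
     ((l (s k))%:Z * (p%:Z - 1) ^+ 2 - 1 <= k%:Z) /\
     (k%:Z < (l (s k).+1)%:Z * (p%:Z - 1) ^+ 2 - 1).
Local Notation m := (m_seq p l s).
Local Notation M := (M_seq p l s).
Local Notation T := (block_start m M).
Local Notation P := (p%:R : R).
Local Notation special := (special p l).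
Local Notation lprev := (lprev l s).
Local Notation special0 := (special0 p l l0).
Local Notation special_incr := (special_incr p l p2 l_incr).
Local Notation special_mono := (special_mono p l p2 l_incr).
Local Notation s_special := (s_special p l s p2 l0 s_spec).
Local Notation lprev_special := (lprev_special p l s p2 l0 l_incr s_spec).
Local Notation m_ge2 := (m_ge2 p l s p2).
Implicit Types (i j k n : nat).

Let P2 : 2 <= P. Proof. by rewrite -[2]/(2%:R) ler_nat. Qed.

Let p1R : (p - 1)%:R = P - 1. Proof. by rewrite natrB// ltnW. Qed.
Let p23R : (2 * p - 3)%:R = 2 * P - 3.
Proof. by rewrite natrB ?natrM//; lia. Qed.

Lemma m_seqR k : (m k)%:R = (P - 1) * (2 * k%:R + (2 * P - 3) * (lprev k)%:R) + 2 * P + 1 :> R.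
Proof. rewrite m_seqE !natrD !natrM !natrD !natrM p1R p23R. ring. Qed.

Lemma M_seqR k : (M k)%:R = 2 * (k%:R + 1) + (2 * P - 3) * (lprev k.+1)%:R :> R.
Proof. rewrite M_seqE natrD !natrM p23R -natr1. ring. Qed.

(** Inserting m_(k+1) = (p-1) M_k + 2p + 1 in the closed form cancels M_k and leaves at most - (2p^2
    - 2p - 1) / (p-1)^2. *)
Lemma block_contracts k : (M k)%:R + zeta_sum p (m k.+1) < 0 :> R.
Proof.
have Pge := P2; rewrite Psi_closed//.
have -> : (m k.+1)%:R = (P - 1) * (M k)%:R + 2 * P + 1.
  rewrite /m_seq; move: (M_seq _ _ _ k) => N; rewrite !natrD !natrM p1R; ring.
have Pm : 0 <= (P ^+ m k.+1)^-1 by rewrite invr_ge0 exprn_ge0.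
have P1 : 0 < P - 1 by lra.
have h0 : 0 <= P / (P - 1) ^+ 2 by rewrite divr_ge0 ?sqr_ge0.
have : P / (P - 1) ^+ 2 * (1 - (P ^+ m k.+1)^-1) <= P / (P - 1) ^+ 2.
  by rewrite ler_piMr//; lra.
have : - ((P - 1) * (M k)%:R + 2 * P + 1) / (P - 1) + P / (P - 1) ^+ 2 =
  - (M k)%:R - (2 * P ^+ 2 - 2 * P - 1) / (P - 1) ^+ 2.
  by field; rewrite gt_eqF.
have : 0 < (2 * P ^+ 2 - 2 * P - 1) / (P - 1) ^+ 2.
  by rewrite divr_gt0 ?exprn_gt0//; nra.
lra.
Qed.

(** The jump of [lprev] just before a special block compensates the constant negative drift since
    the previous one, as special indices differ by (p-1)^2 times the jump of l. The total drift
    between special blocks is therefore zero. *)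
Lemma drift_seq k : drift (R := R) p m M k =
  (2 * P - 3) * ((lprev k.+1)%:R - (lprev k)%:R - ((P - 1) ^+ 2)^-1).
Proof.
have Pge := P2; rewrite /drift m_seqR M_seqR; field.
by rewrite gt_eqF//; lra.
Qed.

Local Notation tau := (threshold (R := R) p m).
Local Notation x := (P ^+ (2 * p - 2))^-1.

Lemma threshold_special i j : (special i + j < special i.+1)%N ->
  tau (special i + j) = tau (special i) * x ^+ j.
Proof.
move=> ij; have Pge := P2; rewrite /threshold -[RHS]mulrA; congr (_ * _).
rewrite exprVn -exprM -invfM -exprD; congr ((_ ^+ _)^-1).
rewrite !m_seqE (lprev_special i)// ?leq_addr//.
rewrite (lprev_special i (special i)) ?leqnn ?special_incr//.
move: (l i) (special i) => a b; nia.
Qed.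

(** This is the origin of q: at k = l_i (p-1)^2 the length m_k is q l_i + 2p + 1. *)
Lemma threshold_special0 i :
  tau (special i) = P / (P - 1) ^+ 2 / P ^+ (q_exp p * l i + 2 * p + 1).
Proof.
rewrite /threshold; congr (_ / _ ^+ _); rewrite m_seqE (lprev_special i) ?leqnn ?special_incr//.
rewrite /special /q_exp; congr (_ + _ + _)%N.
have [r ->] : exists r, p = r.+2 by case: p p2 => [|[|r]]// _; exists r.
move: (l i) => a; nia.
Qed.


Local Notation X := (P ^+ (2 * p - 2)).
Local Notation S := (series (t_term R p l)).
Local Notation L := (limn S).

Let Pneq0 : P != 0. Proof. by rewrite pnatr_eq0 -lt0n ltnW. Qed.
Let P1neq0 : P - 1 != 0. Proof. by have := P2; move=> h; rewrite gt_eqF//; lra. Qed.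

Lemma X_ge4 : 4 <= X.
Proof.
have Pge := P2; have -> : (2 * p - 2)%N = (2 + (2 * p - 4))%N by lia.
rewrite exprD; have : 1 <= P ^+ (2 * p - 4) by apply: exprn_ege1; lra.
have : 4 <= P ^+ 2 by rewrite expr2; nra.
nra.
Qed.

Lemma PX : P ^+ (2 * p - 1) = P * X.
Proof. by rewrite -exprS; congr (_ ^+ _); lia. Qed.

Lemma kappa_ge0_le1 : 0 <= kappa R p <= 1.
Proof.
have Pge := P2; have Xge := X_ge4; rewrite /kappa PX.
have d0 : 0 < P * X - P + 1 by nra.
have X0 : 0 <= X by lra.
rewrite divr_ge0 ?(ltW d0)//= ler_pdivrMr// mul1r.
nra.
Qed.

Lemma t_term_bounds i : 0 <= t_term R p l i <= (P ^+ i)^-1.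
Proof.
have Pge := P2; have /andP[k0 k1] := kappa_ge0_le1.
rewrite /t_term; set y := P ^+ (2 * _ * _); set N := (q_exp p * l i)%N.
have y1 : 1 <= y by apply: exprn_ege1; lra.
have ky : 0 <= kappa R p / y <= 1.
  rewrite divr_ge0 ?(le_trans ler01 y1)//= ler_pdivrMr ?(lt_le_trans ltr01 y1)// mul1r.
  exact: le_trans y1.
have Pi : 0 < P ^+ i by rewrite exprn_gt0//; lra.
have PN : 1 <= P ^+ N by apply: exprn_ege1; lra.
rewrite exprD div1r invfM; apply/andP; split.
  by rewrite !mulr_ge0 ?invr_ge0 ?(ltW Pi) ?(le_trans ler01 PN)//; lra.
rewrite mulrAC -[leRHS]mul1r ler_pM2r ?invr_gt0//.
rewrite mulr_ile1 ?invr_ge0 ?(le_trans ler01 PN)//; try lra.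
by rewrite invf_le1// (lt_le_trans ltr01 PN).
Qed.

(** The terms lie between 0 and p^(-i), so the partial sums increase while S i + 2 / p^i
    decreases. *)
Lemma t_series_bounds :
  (forall i, S i <= L) /\ (forall i, L - S i <= 2 / P ^+ i).
Proof.
have Pge := P2.
have incr : {homo S : i j / (i <= j)%N >-> i <= j}.
  apply/nondecreasing_seqP => i; rewrite seriesSr lerDl.
  by have /andP[] := t_term_bounds i.
have decr i j : (i <= j)%N -> S j + 2 / P ^+ j <= S i + 2 / P ^+ i.
  elim: j => [|j IH]; first by rewrite leqn0 => /eqP ->.
  rewrite leq_eqVlt => /predU1P[->//|/IH h]; apply: le_trans h.
  rewrite seriesSr; have /andP[_ bj] := t_term_bounds j.
  have Pj : 0 < (P ^+ j)^-1 by rewrite invr_gt0 exprn_gt0//; lra.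
  have : 2 / P ^+ j.+1 <= (P ^+ j)^-1.
    rewrite exprS invfM mulrA ler_piMl ?(ltW Pj)// ler_pdivrMr ?mul1r//; lra.
  lra.
have bnd i j : S j <= S i + 2 / P ^+ i.
  have Pi k : 0 <= 2 / P ^+ k by rewrite divr_ge0 ?exprn_ge0//; lra.
  have [ij|/ltnW ji] := leqP i j.
    by have := decr i j ij; have := Pi j; lra.
  by have := incr j i ji; have := Pi i; lra.
have cvS : cvgn S.
  by apply: nondecreasing_is_cvgn => //; exists (S 0 + 2 / P ^+ 0) => _ [j _ <-].
split=> i; first exact: nondecreasing_cvgn_le.
by rewrite lerBlDl; apply: limr_le => //; near=> j; exact: bnd.
Unshelve. all: by end_near.
Qed.

Definition t_const : R :=
  (P ^+ (2 * p - 1) - P + 1) / ((P - 1) ^+ 2 * P ^+ (2 * p + 1) * (X - 1)).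

(* The excess of the radius exponent over - p / (p - 1)^2 at the special blocks:
   a rescaled tail of the series defining t. *)
Definition excess (i : nat) : R := P ^+ i * (t_const * (L - S i)).

Lemma t_constE : t_const = (P * X - P + 1) / ((P - 1) ^+ 2 * (P ^+ 3 * X) * (X - 1)).
Proof.
by rewrite /t_const PX; congr (_ / (_ * _ * _)); rewrite -exprD; congr (_ ^+ _); lia.
Qed.

Lemma t_const_gt0 : 0 < t_const.
Proof.
have Pge := P2; have Xge := X_ge4; rewrite t_constE divr_gt0//; first by nra.
by rewrite !mulr_gt0 ?exprn_gt0//; lra.
Qed.

Lemma excess0 : t_exp R p l = - (P / (P - 1) ^+ 2) + excess 0.
Proof. by rewrite /t_exp /excess expr0 mul1r /series /= big_nil subr0. Qed.

Lemma excess_bound i : excess i * (P * (P - 1) ^+ 2) <= 1.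
Proof.
have Pge := P2; have Xge := X_ge4; have C0 := t_const_gt0.
have [_ /(_ i) Li] := t_series_bounds.
have Pi : 0 < P ^+ i by rewrite exprn_gt0//; lra.
have : excess i <= 2 * t_const.
  rewrite /excess mulrCA mulrC ler_pM2r// mulrC -ler_pdivlMr//.
move=> le2; apply: (@le_trans _ _ (2 * t_const * (P * (P - 1) ^+ 2))).
  by rewrite ler_wpM2r// mulr_ge0 ?sqr_ge0//; lra.
rewrite t_constE.
have -> : 2 * ((P * X - P + 1) / ((P - 1) ^+ 2 * (P ^+ 3 * X) * (X - 1))) * (P * (P - 1) ^+ 2)
   = 2 * (P * X - P + 1) / (P ^+ 2 * X * (X - 1)).
  field. rewrite P1neq0 Pneq0 expf_neq0//=; rewrite gt_eqF//; lra.
rewrite ler_pdivrMr ?mul1r; last by rewrite !mulr_gt0 ?exprn_gt0//; lra.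
apply: (@le_trans _ _ (2 * P * X)); first by nra.
have -> : P ^+ 2 * X * (X - 1) = (P * (X - 1)) * (P * X) by ring.
rewrite -mulrA ler_wpM2r//; first by rewrite mulr_ge0; lra.
nra.
Qed.

(** The identity for which the terms of the series and [kappa] are designed: the excess loses the
    threshold of the special block, is multiplied by p, then loses the thresholds of the later
    blocks, a geometric sum of ratio x. *)
Lemma excess_step i : excess i.+1 =
  P * (excess i - tau (special i) *
    (1 + P^-1 * ((x - x ^+ (special i.+1 - special i)) / (1 - x)))).
Proof.
have Pge := P2; have Xge := X_ge4.
rewrite /excess seriesSr.
have -> : P ^+ i.+1 * (t_const * (L - (S i + t_term R p l i))) =
  P * (P ^+ i * (t_const * (L - S i)) - t_const * (P ^+ i * t_term R p l i)).
  by rewrite exprS; ring.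
congr (_ * (_ - _)); rewrite t_constE threshold_special0 /t_term /kappa PX.
(* The exponent in the series counts the blocks between two special ones, weighted by the decay 2p -
   2 of the thresholds. *)
have -> : (2 * (p - 1) ^ 3 * (l i.+1 - l i))%N = ((2 * p - 2) * (special i.+1 - special i))%N.
  rewrite /special -mulnBl; have := l_incr i.
  have -> : (2 * p - 2 = 2 * (p - 1))%N by lia.
  rewrite expnS; move: (_ - l i)%N ((p - 1) ^ 2)%N => a b _; lia.
rewrite exprM -!exprVn !exprVn; set Y := X ^+ _.
have -> : P ^+ (q_exp p * l i + 2 * p + 1) = P ^+ (q_exp p * l i) * (P ^+ 3 * X).
  by rewrite -!exprD; congr (_ ^+ _); lia.
rewrite exprD; set Q := P ^+ (q_exp p * l i).
have Q0 : Q != 0 by rewrite expf_neq0.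
have Y0 : Y != 0 by rewrite expf_neq0// expf_neq0.
have Pi0 : P ^+ i != 0 by rewrite expf_neq0.
move: Xge; set x' := X => Xge.
have X0 : x' != 0 by rewrite expf_neq0.
field.
have -> : x' - 1 != 0 by rewrite gt_eqF//; lra.
rewrite Pneq0 P1neq0 X0 Q0 Y0 Pi0 /=.
by rewrite gt_eqF//; nra.
Qed.

Lemma threshold_gt0 k : 0 < tau k.
Proof.
have Pge := P2; rewrite /threshold !divr_gt0 ?exprn_gt0//; lra.
Qed.

Lemma x_lt1 : 0 < x < 1.
Proof.
have Xge := X_ge4; have X0 : 0 < X by lra.
by rewrite invr_gt0 X0 invf_lt1//; lra.
Qed.

(** The next excess is a nonnegative tail, and in [excess_step] the threshold is multiplied by a
    factor at least 1. *)
Lemma threshold_le_excess i : tau (special i) <= excess i.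
Proof.
have Pge := P2; have [/(_ i.+1) Li _] := t_series_bounds.
have := excess_step i; have : 0 <= excess i.+1.
  by rewrite /excess mulr_ge0 ?exprn_ge0// (mulr_ge0 (ltW t_const_gt0))// subr_ge0.
move=> e0 eE; rewrite eE pmulr_rge0 in e0; last by lra.
have t0 := threshold_gt0 (special i); have /andP[x0 x1] := x_lt1.
have : 0 <= P^-1 * ((x - x ^+ (special i.+1 - special i)) / (1 - x)).
  rewrite mulr_ge0 ?invr_ge0 ?divr_ge0 ?subr_ge0//; try lra.
  rewrite -[leRHS]expr1 ler_wiXn2l ?(ltW x0) ?(ltW x1)// subn_gt0.
  exact: special_incr.
move: e0; set g := _ * (_ / _) => e0 g0.
have : 0 <= tau (special i) * g by rewrite mulr_ge0// ltW.
lra.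
Qed.

Section Along_orbit.
Variable e : nat -> R.
Hypothesis eE : forall k i, (i < m k)%N -> e (T k + i)%N = zeta p (m k - i).
Local Notation rh := (rho p (block_word m M) e (t_exp R p l)).
Local Notation h := (P / (P - 1) ^+ 2).

Let small_excess i (sg : R) : sg <= excess i -> P * (P - 1) * sg <= 1.
Proof.
have Pge := P2; move=> sgi; have := excess_bound i; have t0 := threshold_gt0 (special i).
have ti := threshold_le_excess i => eb.
apply: (@le_trans _ _ (P * (P - 1) * excess i)).
  by rewrite ler_wpM2l// mulr_ge0; lra.
apply: le_trans eb; rewrite [leLHS]mulrC; apply: ler_wpM2l; first by lra.
rewrite expr2 mulrA ler_peMr//; last lra.
by rewrite mulr_ge0; lra.
Qed.

Lemma special_div i : (special i)%:R / (P - 1) ^+ 2 = (l i)%:R.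
Proof. by rewrite /special natrM natrX p1R mulfK// expf_neq0. Qed.

Lemma after_special_le0 i j : (special i + j.+1 < special i.+1)%N ->
  P * (excess i - tau (special i))
    - tau (special i) * ((x - x ^+ j.+1) / (1 - x))
    + (2 * P - 3) * ((lprev (special i + j.+1))%:R - (special i + j.+1)%:R / (P - 1) ^+ 2) <= 0.
Proof.
have Pge := P2; have /andP[x0 x1] := x_lt1; move=> lt_ij.
have sE := special_div i.
rewrite (lprev_special i); last by rewrite leq_addr.
rewrite natrD (mulrDl (special i)%:R) sE.
have -> : (l i)%:R - ((l i)%:R + j.+1%:R / (P - 1) ^+ 2) = - ((j%:R + 1) / (P - 1) ^+ 2).
  by rewrite -natr1; ring.
rewrite mulrN.
have t0 := threshold_gt0 (special i).
have g0 : 0 <= (x - x ^+ j.+1) / (1 - x).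
  rewrite divr_ge0 ?subr_ge0 ?(ltW x1)// -[leRHS]expr1 ler_wiXn2l ?(ltW x0) ?(ltW x1)//.
have : 0 <= tau (special i) * ((x - x ^+ j.+1) / (1 - x)) by rewrite mulr_ge0// ltW.
have P10 : 0 < (P - 1) ^+ 2 by rewrite exprn_gt0//; lra.
have eb : P * excess i <= ((P - 1) ^+ 2)^-1.
  rewrite -[leRHS]mul1r ler_pdivlMr//; have := excess_bound i; lra.
have i0 : 0 < ((P - 1) ^+ 2)^-1 by rewrite invr_gt0.
have : ((P - 1) ^+ 2)^-1 <= (2 * P - 3) * ((j%:R + 1) / (P - 1) ^+ 2).
  rewrite mulrA ler_peMl ?(ltW i0)//.
  have : 0 <= j%:R :> R by []. 
  nra.
have : 0 < P * tau (special i) by rewrite mulr_gt0//; lra.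
rewrite mulrBr; move: (tau (special i) * (_ / _)) ((2 * P - 3) * (_ / _)) => a b.
lra.
Qed.

Lemma rho_after_special i j : (special i + j.+1 <= special i.+1)%N ->
  rh (T (special i)) = - h + excess i ->
  rh (T (special i + j.+1)) = - h + (P * (excess i - tau (special i))
    - tau (special i) * ((x - x ^+ j.+1) / (1 - x))
    + (2 * P - 3) * ((lprev (special i + j.+1))%:R - (special i + j.+1)%:R / (P - 1) ^+ 2)).
Proof.
have Pge := P2; have /andP[x0 x1] := x_lt1; move=> + r0.
have sE := special_div i.
have xn : 1 - x != 0 by rewrite gt_eqF//; lra.
elim: j => [|j IH] ij.
  rewrite addn1 (rho_block p p2 _ _ _ m_ge2 eE _ _ _ r0 (small_excess i _ (lexx _))).
  rewrite max_r; last first.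
    by rewrite mulr_ge0 ?subr_ge0 ?threshold_le_excess//; lra.
  rewrite drift_seq (lprev_special i (special i)) ?leqnn ?special_incr//.
  rewrite expr1 subrr mul0r mulr0 subr0 -[(special i).+1%:R]natr1.
  rewrite (mulrDl (special i)%:R) sE; ring.
have lt_ij : (special i + j.+1 < special i.+1)%N by rewrite -addnS.
have IHj := IH (ltnW lt_ij).
have le0 := after_special_le0 i j lt_ij.
have tk0 := threshold_gt0 (special i + j.+1).
rewrite addnS (rho_block p p2 _ _ _ m_ge2 eE _ _ _ IHj); last first.
  by apply: le_trans (ler01); rewrite mulr_ge0_le0// mulr_ge0; lra.
rewrite max_l; last by rewrite mulr_ge0_le0//; lra.
rewrite drift_seq threshold_special// -[(_ + j.+1).+1%:R]natr1 (exprS x j.+1).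
move: x xn => y yn; field.
by rewrite P1neq0.
Qed.

Lemma rho_special i : rh (T (special i)) = - h + excess i.
Proof.
elim: i => [|i IH].
  by rewrite special0 /block_start big_ord0 /= excess0.
have lt_i := special_incr i.
have := rho_after_special i (special i.+1 - special i).-1.
rewrite prednK ?subn_gt0// subnKC ?(ltnW lt_i)// leqnn => /(_ isT IH) ->.
have sE := special_div i.+1.
rewrite (lprev_special i.+1) ?leqnn ?special_incr// sE subrr mulr0 addr0 excess_step.
congr (_ + _); set g := (_ / (1 - _)).
have -> : P * (excess i - tau (special i) * (1 + P^-1 * g)) =
  P * (excess i - tau (special i)) - P * P^-1 * (tau (special i) * g) by ring.
by rewrite divff// mul1r.
Qed.

Lemma special_decomp k : exists i, (special i <= k < special i.+1)%N.
Proof.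
case: k => [|k]; last by exists (s k); exact: s_special.
by exists 0%N; have := special_incr 0; rewrite special0.
Qed.

(** Since p (p-1) sg <= 1, multiplying - h + sg by p - 1 gives at most -1, whereas (p-1) zeta <
    1. *)
Lemma rho_start_lt k : rh (T k) < - zeta p (m k).
Proof.
have Pge := P2; have [i /andP[ik ki]] := special_decomp k.
have [sg -> sg1] : exists2 sg, rh (T k) = - h + sg & P * (P - 1) * sg <= 1.
  have [->|si] := eqVneq k (special i).
    by exists (excess i); [exact: rho_special | exact: (small_excess i)].
  have kE : k = (special i + (k - special i).-1.+1)%N.
    by rewrite prednK ?subnKC// subn_gt0 ltn_neqAle eq_sym si.
  move: ki; rewrite kE; set j := _.-1 => ki.
  rewrite (rho_after_special _ _ (ltnW ki) (rho_special i)).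
  have le0 := after_special_le0 i j ki; eexists; first by [].
  by apply: le_trans ler01; rewrite mulr_ge0_le0// mulr_ge0; lra.
have zlt := @zeta_lt R p p2 (m k).
have hE : (P - 1) * h = 1 + (P - 1)^-1 by field; rewrite P1neq0.
have iP : P * sg <= (P - 1)^-1.
  have Pm1 : 0 < P - 1 by lra.
  by rewrite -[leRHS]mul1r ler_pdivlMr// mulrAC.
have P1pos : 0 < P - 1 by lra.
rewrite -(ltr_pM2l P1pos) mulrN mulrDr mulrN hE.
have [sg0|sg0] := lerP sg 0.
  have : (P - 1) * sg <= 0 by rewrite mulr_ge0_le0// ltW.
  have : 0 < (P - 1)^-1 by rewrite invr_gt0.
  lra.
lra.
Qed.

(** The gap to the exponents started at t is multiplied by p at each special block and never
    shrinks, while those exponents are at least - h at the special times. *)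
Lemma rho_larger_escapes t' : t_exp R p l < t' ->
  exists n, 0 <= rho p (block_word m M) e t' n.
Proof.
have Pge := P2; have P1 : 1 < P by lra.
set t := t_exp R p l => tt'; set rh' := rho p (block_word m M) e t'.
have d0 : 0 < t' - t by rewrite subr_gt0.
have grow i : P ^+ i * (t' - t) <= rh' (T (special i)) - rh (T (special i)).
  elim: i => [|i IH]; first by rewrite special0 /block_start big_ord0 expr0 mul1r.
  have thr : - h + tau (special i) <= rh (T (special i)).
    by rewrite rho_special lerD2l threshold_le_excess.
  have := rho_diff_mul p p2 _ _ _ m_ge2 eE t t' _ (ltW tt') thr.
  have TT : ((T (special i)).+1 <= T (special i.+1))%N.
    have : (special i < special i.+1)%N := special_incr i.
    elim: (special i.+1) => // k IHk; rewrite ltnS leq_eqVlt => /predU1P[->|/IHk].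
      by rewrite block_startS; have := m_ge2 k; lia.
    by rewrite block_startS; lia.
  have := rho_diff_mono p p2 m M e t t' _ _ (ltW tt') TT.
  move=> h1 h2; apply: le_trans h1; apply: le_trans h2.
  by rewrite exprS -mulrA ler_wpM2l//; lra.
have [i hi] := exprn_unbounded P P1 (h / (t' - t)).
exists (T (special i)); have := grow i.
have e0 : 0 <= excess i.
  by apply: le_trans (threshold_le_excess i); rewrite ltW// threshold_gt0.
rewrite rho_special; rewrite ltr_pdivrMr// in hi.
rewrite -/rh'; lra.
Qed.

End Along_orbit.

End Exponent.

(** * The Berkovich line *)

Section Seminorms.
Context {R : realType} {K : fieldType} (v : ultranorm R K).
Implicit Types (x : berkA1 v) (g h : {poly K}) (c z : K).

Definition sn x g : R := \val x g.

Lemma sn_seminorm x : multiplicative_seminorms v (\val x).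
Proof. exact: set_mem (valP x). Qed.

Lemma sn_ge0 x g : 0 <= sn x g. Proof. by have [] := sn_seminorm x. Qed.

Lemma snC x c : sn x c%:P = v c. Proof. by have [] := sn_seminorm x. Qed.

Lemma snM x g h : sn x (g * h) = sn x g * sn x h.
Proof. by have [] := sn_seminorm x. Qed.

Lemma sn_triangle x g h : sn x (g + h) <= sn x g + sn x h.
Proof. by have [] := sn_seminorm x. Qed.

Lemma sn0 x : sn x 0 = 0. Proof. by rewrite -[0]/(0%:P) snC un0. Qed.

Lemma sn1 x : sn x 1 = 1. Proof. by rewrite -[1]/(1%:P) snC un1. Qed.

Lemma snX x g n : sn x (g ^+ n) = sn x g ^+ n.
Proof. by elim: n => [|n IH]; rewrite ?expr0 ?sn1// !exprS snM IH. Qed.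

Lemma snZ x c g : sn x (c *: g) = v c * sn x g.
Proof. by rewrite -mul_polyC snM snC. Qed.

Lemma snN x g : sn x (- g) = sn x g.
Proof. by rewrite -scaleN1r snZ unN un1 mul1r. Qed.

(* The norm of K is bounded by 1 on the integers, so expanding (g + h)^n shows
   sn (g + h)^n <= (n + 1) max(sn g, sn h)^n for all n. *)
Lemma sn_ultra x g h (u : R) : sn x g <= u -> sn x h <= u -> sn x (g + h) <= u.
Proof.
move=> gu hu; rewrite leNgt; apply/negP => lt_u.
have u0 : 0 <= u by apply: le_trans gu; exact: sn_ge0.
set S := sn x (g + h) in lt_u.
have S0 : 0 < S by apply: le_lt_trans lt_u.
have key n : S ^+ n <= n.+1%:R * u ^+ n.
  rewrite -snX exprDn.
  have : forall k, sn x (\sum_(i < k) g ^+ (n - i) * h ^+ i *+ 'C(n, i)) <=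
      \sum_(i < k) sn x (g ^+ (n - i) * h ^+ i *+ 'C(n, i)).
    elim=> [|k IH]; first by rewrite !big_ord0 sn0.
    by rewrite !big_ord_recr /=; apply: le_trans (sn_triangle _ _ _) _; rewrite lerD2r.
  move=> /(_ n.+1) /le_trans; apply.
  rewrite mulr_natl -[n.+1 in leRHS]card_ord -sumr_const ler_sum// => i _.
  rewrite -mulr_natr -polyC_natr snM snC snM !snX.
  apply: le_trans (ler_wpM2l _ (un_nat v _)) _.
    by rewrite mulr_ge0 ?exprn_ge0 ?sn_ge0.
  rewrite mulr1; have -> : u ^+ n = u ^+ (n - i) * u ^+ i.
    by rewrite -exprD subnK// -ltnS.
  by rewrite ler_pM ?exprn_ge0 ?sn_ge0// lerXn2r ?nnegrE ?sn_ge0.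
have [u_eq0|u_neq0] := eqVneq u 0.
  by have := key 1%N; rewrite !expr1 u_eq0 mulr0 leNgt S0.
have u1 : 0 < u by rewrite lt_def u_neq0.
pose d := S / u; have d1 : 1 < d by rewrite ltr_pdivlMr// mul1r.
have keyd n : d ^+ n <= n.+1%:R.
  by rewrite expr_div_n ler_pdivrMr ?exprn_gt0// key.
have bern n : 1 + n%:R * (d - 1) <= d ^+ n.
  elim: n => [|n IH]; first by rewrite mul0r addr0 expr0.
  rewrite exprSr -natr1; apply: le_trans (ler_wpM2r (ltW (lt_trans ltr01 d1)) IH).
  rewrite -subr_ge0 (_ : _ - _ = n%:R * (d - 1) ^+ 2); last by ring.
  by rewrite mulr_ge0 ?sqr_ge0.
have e0 : 0 < d - 1 by rewrite subr_gt0.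
(* For such n the term n^2 (d-1)^2 of (1 + n (d-1))^2 <= d^(2n) exceeds 2n, against d^(2n) <= 2n +
   1. *)
have [n hn] : exists n : nat, 2 / (d - 1) ^+ 2 < n%:R.
  exists (Num.bound (2 / (d - 1) ^+ 2)).
  by apply: le_lt_trans (ler_norm _) _; have := archi_boundP (normr_ge0 (2 / (d - 1) ^+ 2)); rewrite /Num.bound normr_id.
rewrite ltr_pdivrMr ?exprn_gt0// in hn.
have := keyd (2 * n)%N; rewrite mulnC exprM => k2.
have b2 : (1 + n%:R * (d - 1)) ^+ 2 <= d ^+ n ^+ 2.
  have n0 : 0 <= n%:R * (d - 1) by rewrite mulr_ge0// ltW.
  rewrite lerXn2r ?nnegrE ?exprn_ge0 ?bern//; lra.
have := le_trans b2 k2; rewrite leNgt => /negP; apply.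
rewrite -[(n * 2).+1%:R]natr1 natrM.
have n0 : 0 <= n%:R :> R by [].
have [n_eq0|n_neq0] := eqVneq n 0%N; first by rewrite n_eq0 mul0r in hn; lra.
have n1 : 0 < n%:R :> R by rewrite ltr0n lt0n.
have : 2 * n%:R < n%:R * n%:R * (d - 1) ^+ 2 by rewrite mulrC -mulrA ltr_pM2l.
have : 0 < n%:R * (d - 1) by rewrite mulr_gt0.
rewrite (_ : (1 + n%:R * (d - 1)) ^+ 2 = 1 + 2 * (n%:R * (d - 1)) + n%:R * n%:R * (d - 1) ^+ 2); last by ring.
lra.
Qed.

Lemma sn_max x g h : sn x (g + h) <= Num.max (sn x g) (sn x h).
Proof. by apply: sn_ultra; rewrite le_max lexx ?orbT. Qed.

Lemma sn_lt x g h (u : R) : sn x g < u -> sn x h < u -> sn x (g + h) < u.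
Proof. by move=> gu hu; apply: le_lt_trans (sn_max x g h) _; rewrite gt_max gu. Qed.

Lemma sn_eq x g h : sn x h < sn x g -> sn x (g + h) = sn x g.
Proof.
move=> hg; apply/le_anti/andP; split; first by apply: sn_ultra => //; exact: ltW.
have := sn_max x (g + h) (- h); rewrite addrK snN le_max => /orP[//|].
by rewrite leNgt hg.
Qed.

Lemma sn_sum_le (I : Type) (r : seq I) (F : I -> {poly K}) x (u : R) : 0 <= u ->
  (forall i, sn x (F i) <= u) -> sn x (\sum_(i <- r) F i) <= u.
Proof.
move=> u0 Fu; elim/big_rec: _ => [|i g _ gu]; first by rewrite sn0.
exact: sn_ultra.
Qed.

Definition bdist x z : R := sn x ('X - z%:P).

Lemma bdist_ge0 x z : 0 <= bdist x z. Proof. exact: sn_ge0. Qed.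

Lemma XsubC_shift z z' : 'X - z%:P = ('X - z'%:P) + (z' - z)%:P :> {poly K}.
Proof. by rewrite polyCB addrA subrK. Qed.

Lemma bdist_le x z z' (u : R) : bdist x z' <= u -> v (z' - z) <= u -> bdist x z <= u.
Proof. by move=> xu zu; rewrite /bdist (XsubC_shift z z') sn_ultra// snC. Qed.

Lemma bdist_lt x z z' (u : R) : bdist x z' < u -> v (z' - z) < u -> bdist x z < u.
Proof. by move=> xu zu; rewrite /bdist (XsubC_shift z z') sn_lt// snC. Qed.

Lemma bdist_eqK x z z' : bdist x z' < v (z' - z) -> bdist x z = v (z' - z).
Proof. by move=> h; rewrite /bdist (XsubC_shift z z') addrC sn_eq snC. Qed.

Lemma bdist_eq x z z' : v (z' - z) < bdist x z' -> bdist x z = bdist x z'.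
Proof. by move=> h; rewrite /bdist (XsubC_shift z z') sn_eq// snC. Qed.

Lemma un_le_bdist x z z' (u : R) : bdist x z <= u -> bdist x z' <= u -> v (z - z') <= u.
Proof.
move=> xz xz'; rewrite -(snC x) (_ : _%:P = ('X - z'%:P) - ('X - z%:P)).
  by rewrite sn_ultra// snN.
by rewrite polyCB; ring.
Qed.

Definition berk_map (F : {poly K}) x : berkA1 v := SigSub (berk_push_subproof F x).

Definition berk_pt z : berkA1 v := SigSub (berk_eval_subproof v z).

Lemma sn_berk_map F x g : sn (berk_map F x) g = sn x (g \Po F). Proof. by []. Qed.

Lemma sn_berk_pt z g : sn (berk_pt z) g = v g.[z]. Proof. by []. Qed.

Lemma bdist_berk_pt z z' : bdist (berk_pt z) z' = v (z - z').
Proof. by rewrite /bdist sn_berk_pt !hornerE. Qed.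

Lemma berk_ext x y : (forall g, sn x g = sn y g) -> x = y.
Proof. by move=> h; apply: val_inj; apply: funext. Qed.

Lemma berk_map_pt F z : berk_map F (berk_pt z) = berk_pt F.[z].
Proof. by apply: berk_ext => g; rewrite sn_berk_map !sn_berk_pt horner_comp. Qed.

Lemma iter_berk_map_pt F z n :
  iter n (berk_map F) (berk_pt z) = berk_pt (iter n (horner F) z).
Proof. by elim: n => // n IH; rewrite !iterS IH berk_map_pt. Qed.

Lemma iter_berk_poly F x n : iter n (berk_poly F) (Some x : berkP1 v) = Some (iter n (berk_map F) x).
Proof. by elim: n => // n IH; rewrite !iterS IH. Qed.

Lemma berk_pt_inj : injective berk_pt.
Proof.
move=> z z' E; apply/eqP; rewrite -subr_eq0; apply/eqP/(ultranorm_eq0 v).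
by rewrite -bdist_berk_pt E bdist_berk_pt subrr un0.
Qed.

Lemma bdist_berk_map F x z (u w : R) : bdist x z <= u -> 0 <= w ->
  (forall j, (0 < j)%N -> v (taylor_coef F z j) * u ^+ j <= w) ->
  bdist (berk_map F x) F.[z] <= w.
Proof.
move=> xu w0 cw; rewrite /bdist sn_berk_map comp_polyB comp_polyX comp_polyC.
have [n ->] := taylor_sub F z; apply: sn_sum_le => // i.
rewrite snZ snX; apply: le_trans (cw i.+1 isT); rewrite ler_wpM2l ?ultranorm_ge0//.
rewrite lerXn2r ?nnegrE ?bdist_ge0//; exact: le_trans (bdist_ge0 x z) xu.
Qed.

End Seminorms.

(** * Pointwise convergence and compactness of closed Berkovich disks *)

Section Berkovich_topology.
Context {R : realType} {K : fieldType} (v : ultranorm R K).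
Implicit Types (x y : berkA1 v) (g h : {poly K}) (c z : K).

Lemma berk_cvgP (F : set_system (berkA1 v)) x : Filter F ->
  F --> x <-> forall g, sn v y g @[y --> F] --> sn v x g.
Proof.
move=> FF; have E : F --> x <-> (\val @ F : set_system {ptws {poly K} -> R}) --> \val x.
  split=> [Fx A Ax|Fx A [_ [[B oB <-] Bx sBA]]].
    exact: (Fx _ (@initial_continuous _ _ (set_val : berkA1 v -> _) x A Ax)).
  have : nbhs (\val x) B by rewrite nbhsE; exists B.
  by move=> /Fx FB; exact: (filterS sBA FB).
rewrite E.
exact: (@pointwise_cvgP (discrete_topology {poly K}) R (\val @ F) (\val x)).
Qed.

Lemma sn_continuous g : continuous (fun x => sn v x g).
Proof. by move=> x; have /berk_cvgP := @cvg_id _ (nbhs x); apply. Qed.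

Lemma berk_map_continuous (F : {poly K}) : continuous (berk_map v F).
Proof.
move=> x; have FF : Filter (berk_map v F @ nbhs x) by apply: fmap_filter.
suff : berk_map v F @ nbhs x --> berk_map v F x by [].
apply: (proj2 (berk_cvgP _ _ FF)) => g.
exact: (sn_continuous (g \Po F) x).
Qed.

Lemma iter_berk_map_continuous (F : {poly K}) n : continuous (iter n (berk_map v F)).
Proof.
elim: n => [|n IH] x; first exact: cvg_id.
by apply: continuous_comp; [exact: IH | exact: berk_map_continuous].
Qed.

Lemma berk_hausdorff : hausdorff_space (berkA1 v).
Proof.
move=> x y xy; apply: berk_ext => g; apply: (@Rhausdorff R) => A B xA yB.
have [w [Aw Bw]] := xy _ _ (sn_continuous g x A xA) (sn_continuous g y B yB).
by exists (sn v w g).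
Qed.

Lemma open_bdist_lt z (r : R) : open [set x | bdist v x z < r].
Proof.
by apply: (@open_comp _ _ (fun x => sn v x ('X - z%:P)) [set s | s < r]) => [x _|];
  [exact: sn_continuous | exact: open_lt].
Qed.

Lemma open_bdist_gt z (r : R) : open [set x | r < bdist v x z].
Proof.
by apply: (@open_comp _ _ (fun x => sn v x ('X - z%:P)) [set s | r < s]) => [x _|];
  [exact: sn_continuous | exact: open_gt].
Qed.

Lemma closed_bdist_le z (r : R) : closed [set x | bdist v x z <= r].
Proof.
by apply: (@closed_comp _ _ (fun x => sn v x ('X - z%:P)) [set s | s <= r]) => [x _|];
  [exact: sn_continuous | exact: closed_le].
Qed.

Lemma sn_bounded z (r : R) g : exists B, forall x, bdist v x z <= r -> sn v x g <= B.
Proof.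
elim/poly_ind: g => [|g c [B HB]]; first by exists 0 => x _; rewrite sn0.
exists (B * Num.max r (v z) + v c) => x xr.
apply: le_trans (sn_triangle _ _ _ _) _; rewrite snC lerD2r snM.
apply: ler_pM; rewrite ?sn_ge0 ?HB//.
have -> : 'X = ('X - z%:P) + z%:P :> {poly K} by rewrite subrK.
apply: le_trans (sn_max _ _ _ _) _; rewrite snC ge_max !le_max lexx orbT andbT.
by rewrite xr.
Qed.

Lemma ultra_bounded_cvg {T : Type} (F : set_system T) (f : T -> R) (a b : R) :
  UltraFilter F -> (\forall t \near F, a <= f t <= b) -> exists l : R, f @ F --> l.
Proof.
move=> FU Fab; have cpt : compact `[a, b]%classic := @segment_compact R a b.
have PF : ProperFilter (f @ F) by apply: fmap_proper_filter.
have [|l [_ cl]] := cpt (f @ F) PF.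
  by apply: filterS Fab => t /=; rewrite in_itv.
exists l => A lA; have [//|FnA] := in_ultra_setVsetC (f @^-1` A) FU.
by have [s [? ?]] := cl _ A (FnA : (f @ F) (~` A)) lA.
Qed.

(** Along an ultrafilter every polynomial takes bounded values, hence has a limit, and the limits
    again form a multiplicative seminorm. *)
Lemma compact_bdist_le z (r : R) : compact [set x | bdist v x z <= r].
Proof.
rewrite compact_ultra => F FU Fr.
have lim g : exists l : R, sn v x g @[x --> F] --> l.
  have [B HB] := sn_bounded z r g.
  apply: (@ultra_bounded_cvg _ F _ 0 B); apply: filterS Fr => x xr.
  by rewrite sn_ge0 HB.
pose l g := sval (cid (lim g)).
have lE g : sn v x g @[x --> F] --> l g := svalP (cid (lim g)).
have lS : (l : {poly K} -> R) \in multiplicative_seminorms v.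
  apply/mem_set; split=> [g|c|g h|g h].
  - apply: (ler_cvg_to (cvg_cst 0) (lE g)); apply: nearW => x; exact: sn_ge0.
  - apply: (cvg_unique (@Rhausdorff R) (lE c%:P)).
    rewrite (_ : (fun x => sn v x c%:P) = cst (v c)); first exact: cvg_cst.
    by apply/funext => x; rewrite snC.
  - apply: (cvg_unique (@Rhausdorff R) (lE (g * h))).
    rewrite (_ : (fun x => sn v x (g * h)) = (fun x => sn v x g * sn v x h)).
      exact: cvgM.
    by apply/funext => x; rewrite snM.
  - apply: (ler_cvg_to (lE (g + h)) (cvgD (lE g) (lE h))).
    by apply: nearW => x; exact: sn_triangle.
pose L : berkA1 v := SigSub lS.
have FL : F --> L by apply/berk_cvgP => g; exact: lE.
exists L; split=> //=.
by apply: (ler_cvg_to (lE ('X - z%:P)) (cvg_cst r)).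
Qed.

End Berkovich_topology.

(** * Density of the points of K, Gauss points and their neighbourhoods *)

Section Berkovich_line.
Context {R : realType} {K : closedFieldType} (v : ultranorm R K).
Variable a0 : K.
Hypothesis a01 : 1 < v a0.
Implicit Types (x y : berkA1 v) (g h : {poly K}) (c z w : K).

Lemma sn_roots x g : exists r : seq K,
  g = lead_coef g *: \prod_(z <- r) ('X - z%:P) /\
  sn v x g = v (lead_coef g) * \prod_(z <- r) bdist v x z.
Proof.
have [r E] := closed_field_poly_normal g; exists r; split=> //.
rewrite {1}E snZ; congr (_ * _); elim: r {E} => [|z r IH]; first by rewrite !big_nil sn1.
by rewrite !big_cons snM IH.
Qed.

(* Polynomials over K split, so a point is determined by its distances to the
   points of K, and so is convergence. *)
Lemma berk_cvg_bdist (F : set_system (berkA1 v)) x : Filter F ->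
  (forall z, bdist v y z @[y --> F] --> bdist v x z) -> F --> x.
Proof.
move=> FF Fz; apply/berk_cvgP => g.
have [r E] := closed_field_poly_normal g.
have snE y : sn v y g = v (lead_coef g) * \prod_(z <- r) bdist v y z.
  rewrite {1}E snZ; congr (_ * _); elim: (r) => [|z r' IH]; first by rewrite !big_nil sn1.
  by rewrite !big_cons snM IH.
rewrite snE (_ : (fun y => sn v y g) = (fun y => v (lead_coef g) * \prod_(z <- r) bdist v y z)); last first.
  by apply/funext => y; exact: snE.
apply: cvgM; first exact: cvg_cst.
elim: r {E snE} => [|z r IH].
  rewrite big_nil (_ : (fun y => _) = cst 1); first exact: cvg_cst.
  by apply/funext => y; rewrite big_nil.
rewrite big_cons (_ : (fun y => _) = (fun y => bdist v y z * \prod_(z <- r) bdist v y z)).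
  exact: cvgM.
by apply/funext => y; rewrite big_cons.
Qed.

(** Roots exist in K, so its values include all rational powers of |a0|. *)
Lemma value_dense (s r : R) : 0 <= s -> s < r -> exists z, s < v z < r.
Proof.
move=> s0 sr; have r0 : 0 < r by apply: le_lt_trans sr.
have [y yE] := powR_gt1_onto _ a01 _ r0.
have [x xy sx] : exists2 x, x < y & s <= v a0 `^ x.
  have [s_eq0|s_neq0] := eqVneq s 0.
    by exists (y - 1); rewrite ?s_eq0 ?powR_ge0//; lra.
  have s1 : 0 < s by rewrite lt_def s_neq0.
  have [x xE] := powR_gt1_onto _ a01 _ s1; exists x; last by rewrite -xE.
  by rewrite -(ltr_powR_gt1 _ a01) -xE -yE.
have [q] := rat_in_itvoo xy; rewrite in_itv /= => /andP[xq qy].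
have [n qn] : exists n : nat, (0 < n)%N /\ n%:R * ratr q = (numq q)%:~R :> R.
  exists `|denq q|%N; split; first by rewrite absz_gt0 denq_neq0.
  rewrite natr_absz gtr0_norm ?denq_gt0// /ratr mulrC divfK//.
  by rewrite intr_eq0 denq_neq0.
case: qn => n0 qn.
have [z zE] := solve_monicpoly (fun i => if i == 0%N then a0 ^ (numq q) else 0) n0.
have {}zE : z ^+ n = a0 ^ (numq q).
  rewrite zE -(prednK n0) big_ord_recl /= expr0 mulr1 big1 ?addr0// => i _.
  by rewrite mul0r.
have vint (i : int) : v (a0 ^ i) = v a0 `^ i%:~R.
  rewrite powR_intmul ?ultranorm_ge0//; case: i => k; first by rewrite unX.
  by rewrite NegzE -!exprnN unV unX.
exists z; have -> : v z = v a0 `^ ratr q.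
  apply/eqP; rewrite -(@eqrXn2 _ n) ?ultranorm_ge0 ?powR_ge0//.
  by rewrite -unX zE vint powR_gt1X// qn.
by rewrite yE (le_lt_trans sx) ltr_powR_gt1.
Qed.

Lemma near_pt x (s : seq K) (e : R) : 0 < e -> exists w, forall z, z \in s ->
  bdist v x z <= v (w - z) <= bdist v x z + e.
Proof.
move=> e0; have [->|s0] := eqVneq s [::]; first by exists 0.
have [b bs bmin] : exists2 b, b \in s & forall z, z \in s -> bdist v x b <= bdist v x z.
  elim: s s0 => // b s IH _; have [->|s0] := eqVneq s [::].
    by exists b; rewrite ?mem_head// => z; rewrite inE => /eqP ->.
  have [b' b's b'min] := IH s0; have [le|/ltW le] := leP (bdist v x b) (bdist v x b').
    exists b; rewrite ?mem_head// => z; rewrite inE => /predU1P[->//|/b'min].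
    exact: le_trans.
  by exists b'; rewrite ?inE ?b's ?orbT// => z; rewrite inE => /predU1P[->//|/b'min].
set u := bdist v x b in bmin.
(* With b the center nearest to x, a point w at distance between u and r from b sees centers within
   u of b at that distance, and every other center at its distance from b. *)
have [r ur [re rs]] : exists2 r, u < r & r <= u + e /\
    forall z, z \in s -> u < v (b - z) -> r <= v (b - z).
  have : u < u + e by rewrite ltrDl.
  elim: (s) => [|z s' IH] ue; first by exists (u + e).
  have [r ur [re rs]] := IH ue.
  have [uz|zu] := ltP u (v (b - z)).
    exists (Num.min r (v (b - z))); first by rewrite lt_min ur.
    split; first by rewrite ge_min re.
    by move=> z'; rewrite inE ge_min => /predU1P[->|/rs h /h ->//]; rewrite lexx orbT.
  exists r => //; split=> // z'; rewrite inE => /predU1P[->|]; last exact: rs.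
  by rewrite ltNge zu.
have [y /andP[uy yr]] := value_dense u r (bdist_ge0 v x b) ur.
exists (b + y) => z zs; have wb : v (b + y - b) = v y by rewrite addrC addKr.
have [lt_u|le_u] := ltP u (v (b - z)).
  have yz : v y < v (b - z) by apply: lt_le_trans yr (rs z zs lt_u).
  have -> : v (b + y - z) = v (b - z).
    by rewrite -addrA [y - z]addrC addrA unD_eq.
  by rewrite (bdist_eqK v x z b)// lexx lerDl ltW.
have -> : bdist v x z = u by apply/le_anti; rewrite bmin// (bdist_le v x z b).
have -> : v (b + y - z) = v y.
  by rewrite -addrA [y - z]addrC addrA unD_eqr// (le_lt_trans le_u).
by rewrite (ltW uy) (le_trans (ltW yr)).
Qed.

Definition approx_filter x : set_system K := [set S | exists (s : seq K) (e : R),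
  0 < e /\ forall w, (forall z, z \in s -> bdist v x z <= v (w - z) <= bdist v x z + e) -> S w].

Lemma approx_filter_proper x : ProperFilter (approx_filter x).
Proof.
apply: Build_ProperFilter.
  case=> s [e [e0 H]]; have [w hw] := near_pt x s e e0; exact: H hw.
split.
- by exists [::], 1.
- move=> S S' [s [e [e0 H]]] [s' [e' [e'0 H']]].
  exists (s ++ s'), (Num.min e e'); split; first by rewrite lt_min e0.
  move=> w hw; split; [apply: H | apply: H'] => z zs.
    have /hw/andP[-> h] : z \in s ++ s' by rewrite mem_cat zs.
    by rewrite (le_trans h)// lerD2l ge_min lexx.
  have /hw/andP[-> h] : z \in s ++ s' by rewrite mem_cat zs orbT.
  by rewrite (le_trans h)// lerD2l ge_min lexx orbT.
- move=> S S' SS' [s [e [e0 H]]]; exists s, e; split=> // w /H; exact: SS'.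
Qed.

Lemma approx_filter_cvg x : berk_pt v w @[w --> approx_filter x] --> x.
Proof.
have PF := approx_filter_proper x.
apply: berk_cvg_bdist => z; apply/cvgrPdist_le => e e0.
exists [:: z], e; split=> // w /(_ z (mem_head _ _)) /andP[l1 l2].
by rewrite /= bdist_berk_pt distrC ger0_norm ?subr_ge0// lerBlDl.
Qed.

Lemma berk_pt_dense x z (r : R) (C : set (berkA1 v)) : closed C -> bdist v x z < r ->
  (forall w, v (w - z) <= r -> C (berk_pt v w)) -> C x.
Proof.
move=> cC xr Cw; have PF := approx_filter_proper x.
apply: (closed_cvg C cC _ x (approx_filter_cvg x)).
exists [:: z], (r - bdist v x z); split; first by rewrite subr_gt0.
move=> w /(_ z (mem_head _ _)) /andP[_ h]; apply: Cw.
by apply: le_trans h _; rewrite subrKC.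
Qed.

(* The Gauss point of a disk, obtained by compactness as a limit of points of K
   at distances from z decreasing to s. *)
Lemma disk_pt z (s : R) : 0 <= s -> exists x, forall w, bdist v x w = Num.max s (v (z - w)).
Proof.
move=> s0.
pose F : set_system K := [set S | exists2 r, s < r & forall w, s < v (w - z) < r -> S w].
have PF : ProperFilter F.
  apply: Build_ProperFilter.
    case=> r sr H; have [y ysr] := value_dense s r s0 sr.
    by apply: (H (z + y)); rewrite addrC addKr.
  split.
  - by exists (s + 1) => //; rewrite ltrDl.
  - move=> S S' [r sr H] [r' sr' H']; exists (Num.min r r'); first by rewrite lt_min sr.
    by move=> w; rewrite lt_min => /andP[sw /andP[h h']]; split; [apply: H|apply: H']; rewrite sw.
  - by move=> S S' SS' [r sr H]; exists r => // w /H; exact: SS'.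
have PF' : ProperFilter (berk_pt v @ F) by apply: fmap_proper_filter.
have [G [GU FG]] := ultraFilterLemma PF'.
have := compact_bdist_le v z (s + 1); rewrite compact_ultra => /(_ G GU) [].
  apply: FG; exists (s + 1); first by rewrite ltrDl.
  by move=> w /andP[_ /ltW]; rewrite /= bdist_berk_pt.
move=> x [_ Gx]; exists x => w.
have PG : ProperFilter G by apply: ultra_proper.
have GF : Filter G by apply: filter_filter.
have c1 : bdist v y w @[y --> G] --> bdist v x w := proj1 (berk_cvgP v G x GF) Gx ('X - w%:P).
apply: (cvg_unique (@Rhausdorff R) c1).
apply: (@cvg_trans _ (bdist v y w @[y --> berk_pt v @ F])); first by move=> A; exact: FG.
apply/cvgrPdist_le => e e0.
have [zw|wz] := leP (v (z - w)) s.
  exists (s + e); first by rewrite ltrDl.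
  move=> w' /andP[sw' w'e]; rewrite /= bdist_berk_pt.
  have -> : v (w' - w) = v (w' - z).
    by rewrite -(subrKA z) unD_eq// (le_lt_trans zw).
  by rewrite distrC ger0_norm ?subr_ge0 ?(ltW sw')// lerBlDl ltW.
exists (v (z - w)) => // w' /andP[sw' w'z]; rewrite /= bdist_berk_pt.
have -> : v (w' - w) = v (z - w) by rewrite -(subrKA z) unD_eqr.
by rewrite subrr normr0 ltW.
Qed.

(** The absolute value of s makes this a map on the whole real line, so that real segments give
    paths. *)
Definition disk_point z (s : R) : berkA1 v := sval (cid (disk_pt z _ (normr_ge0 s))).

Lemma bdist_disk_point z (s : R) w : bdist v (disk_point z s) w = Num.max `|s| (v (z - w)).
Proof. exact: (svalP (cid (disk_pt z _ (normr_ge0 s)))). Qed.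

Lemma bdist_ext x y : (forall z, bdist v x z = bdist v y z) -> x = y.
Proof.
move=> xy; apply: berk_ext => g; have [r [E ->]] := sn_roots x g.
rewrite [in RHS]E snZ; congr (_ * _); elim: r {E} => [|z r IH]; first by rewrite !big_nil sn1.
by rewrite !big_cons snM -IH xy.
Qed.

Lemma disk_point0 z : disk_point z 0 = berk_pt v z.
Proof.
by apply: bdist_ext => w; rewrite bdist_disk_point bdist_berk_pt normr0 max_r ?ultranorm_ge0.
Qed.

Lemma disk_point_eq z z' (s : R) : v (z - z') <= `|s| -> disk_point z s = disk_point z' s.
Proof.
move=> zz; apply: bdist_ext => w; rewrite !bdist_disk_point.
have [h|h] := leP (v (z - w)) `|s|.
  by apply/esym/max_l; rewrite -(subrKA z) unD_le// un_distC.
have -> : v (z' - w) = v (z - w); last by rewrite max_r// ltW.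
by rewrite -(subrKA z) unD_eqr// un_distC (le_lt_trans zz).
Qed.

Lemma disk_point_continuous z : continuous (disk_point z).
Proof.
move=> s; have FF : Filter (disk_point z @ nbhs s) by apply: fmap_filter.
suff : disk_point z @ nbhs s --> disk_point z s by [].
apply: berk_cvg_bdist => w; rewrite bdist_disk_point.
suff : (fun t => bdist v (disk_point z t) w) @ nbhs s --> Num.max `|s| (v (z - w)) by [].
have -> : (fun t => bdist v (disk_point z t) w) = (fun t : R => `|t|) \max cst (v (z - w)).
  by apply/funext => t; rewrite bdist_disk_point.
apply: (@continuous_max R R (fun t => `|t|) (cst (v (z - w))) s).
  exact: norm_continuous.
exact: cvg_cst.
Qed.

(** The hypotheses say that x is the Gauss point of the disk. For y in a thin annulus around it, the
    distance to a center in the disk is that to z, close to r, and the distance to any other center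
    is the one from x. *)
Lemma annulus_nbhs x z (r : R) (V : set (berkA1 v)) : bdist v x z = r ->
  (forall w, v (z - w) <= r -> bdist v x w = r) -> nbhs x V ->
  exists2 r', r < r' & forall y, r < bdist v y z < r' -> V y.
Proof.
move=> xz xr.
pose F : set_system (berkA1 v) :=
  [set S | exists2 r', r < r' & forall y, r < bdist v y z < r' -> S y].
have FF : Filter F.
  split.
  - by exists (r + 1) => //; rewrite ltrDl.
  - move=> S S' [r1 h1 H1] [r2 h2 H2]; exists (Num.min r1 r2); first by rewrite lt_min h1.
    by move=> w; rewrite lt_min => /andP[sw /andP[h h']]; split; [apply: H1|apply: H2]; rewrite sw.
  - by move=> S S' SS' [r1 h1 H1]; exists r1 => // w /H1; exact: SS'.
suff Fx : F --> x by move=> /Fx.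
apply: berk_cvg_bdist => w; apply/cvgrPdist_le => e e0.
have [zw|wz] := leP (v (z - w)) r.
  exists (r + e); first by rewrite ltrDl.
  move=> y /andP[ry ye] /=; rewrite xr// (bdist_eq v y w z) ?(le_lt_trans zw)//.
  by rewrite distrC ger0_norm ?subr_ge0 ?(ltW ry)// lerBlDl ltW.
exists (v (z - w)) => // y /andP[_ yw] /=.
by rewrite (bdist_eqK v y w z)// (bdist_eqK v x w z) ?xz// subrr normr0 ltW.
Qed.

End Berkovich_line.

(** * The wandering component *)

Section Wandering_ball.
Context {R : realType} {K : closedFieldType} (v : ultranorm R K) (p : nat) (a x0 : K).
Variables (theta : nat -> bool) (e : nat -> R) (t : R).
Hypotheses (p_prime : prime p) (vp : v p%:R < 1) (va : 1 < v a).
Local Notation A := (v a).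
Local Notation f := (Pa_map p a).
Local Notation F n := (iter n f x0).
Local Notation r := (A `^ t).
Local Notation rh := (rho p theta e).
Hypothesis orbit0 : forall n, ~~ theta n ->
  [/\ v (F n) = A `^ (- e n), v (F n) < 1 & v p%:R < v (F n)].
Hypothesis orbit1 : forall n, theta n -> v (F n - 1) < 1.
Hypothesis rho_lt : forall n, rh t n < if theta n then 0 else - e n.
Hypothesis rho_esc : forall t', t < t' -> exists n, 0 <= rh t' n.
Hypothesis theta_aper : forall i j, i != j -> exists n, theta (i + n)%N != theta (j + n)%N.
Hypothesis theta_zeros : forall N, exists2 n, (N <= n)%N & ~~ theta n.
Hypothesis orbit_near1 : forall (eps : R) N, 0 < eps ->
  exists2 n, (N <= n)%N & v (F n - 1) <= eps /\ A `^ rh t n <= eps.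
Implicit Types (n N : nat) (w y z : K) (x : berkA1 v).

Let A0 : 0 < A. Proof. exact: lt_trans va. Qed.
Let r_gt0 : 0 < r. Proof. exact: powR_gt0. Qed.

(** Pull w back step by step: the Taylor coefficient of order 1 or p, whichever gives the maximum in
    [rho], is large enough for surjectivity. *)
Lemma disk_image_lower n t' w : v (w - F n) <= A `^ rh t' n ->
  exists2 y, v (y - x0) <= A `^ t' & iter n f y = w.
Proof.
elim: n w => [|n IH] w; first by move=> wx; exists w.
move=> wn; suff [h hn hw] : exists2 h, v (h - F n) <= A `^ rh t' n & f h = w.
  by have [y yt yh] := IH h hn; exists y => //; rewrite iterS yh.
have s0 : 0 < A `^ rh t' n by exact: powR_gt0.
have E1 : A `^ 1 = A by rewrite powRr1// ltW.
have [th|th] := boolP (theta n).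
  apply: (disk_surj v (Pa p a) (F n) w _ 1%N s0 isT).
  apply: le_trans wn _; rewrite /= th powR_gt1D// E1 expr1.
  have vF := un_near1 v _ (orbit1 n th).
  by rewrite (un_taylor1 v p p_prime vp a va) vF ?expr1n ?mulr1.
have [vF F1 pF] := orbit0 n th.
move: wn; rewrite /= (negbTE th) powR_gt1D// E1.
have [le_m|le_m] := leP (p%:R * rh t' n) (rh t' n - p%:R * e n) => wn.
  apply: (disk_surj v (Pa p a) (F n) w _ 1%N s0 isT); apply: le_trans wn _.
  rewrite (un_taylor1 v p p_prime vp a va)// expr1 vF powR_gt1X// -mulrA -powR_gt1D//.
  by rewrite mulrN [- _ + _]addrC.
apply: (disk_surj v (Pa p a) (F n) w _ p s0 (prime_gt0 p_prime)); apply: le_trans wn _.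
by rewrite (un_taylorp v p a va)// powR_gt1X.
Qed.

Local Notation bf := (berk_map v (Pa p a)).
Local Notation B x n := (iter n bf x).

Lemma berk_orbit_upper x n : bdist v x x0 <= r -> bdist v (B x n) (F n) <= A `^ rh t n.
Proof.
move=> xr; elim: n => [|n IH] //.
have E1 : A `^ 1 = A by rewrite powRr1// ltW.
have s0 : 0 <= A `^ rh t n by exact: powR_ge0.
rewrite !iterS; apply: bdist_berk_map IH _ _; first exact: powR_ge0.
move=> j j0; have := rho_lt n; rewrite /= powR_gt1D// E1.
have [th|th] := boolP (theta n) => lt_n.
  apply: taylor_Pa_bound1 => //; first by rewrite (un_near1 v _ (orbit1 n th)).
  by rewrite -(powRr0 A) ler_powR_gt1// ltW.
have [vF F1 pF] := orbit0 n th.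
apply: le_trans (taylor_Pa_bound0 v p p_prime vp a va _ _ _ pF F1 s0 _ j0) _.
  by rewrite vF ltr_powR_gt1.
rewrite vF !powR_gt1X// ge_max -mulrA -powR_gt1D// !ler_pM2l// !ler_powR_gt1//.
by rewrite !le_max lexx mulrN [- _ + _]addrC lexx orbT.
Qed.

Definition ball0 : set (berkA1 v) := [set x | bdist v x 0 < 1].
Definition ball1 : set (berkA1 v) := [set x | bdist v x 1 < 1].

Lemma ball01 : ball0 `&` ball1 = set0.
Proof.
apply/seteqP; split=> // x [b0 b1].
have := un_le_bdist v x 0 1 (Num.max (bdist v x 0) (bdist v x 1)).
rewrite !le_max !lexx orbT sub0r unN un1 => /(_ isT isT).
by rewrite !leNgt b0 b1.
Qed.

Lemma berk_itinerary x n : bdist v x x0 <= r ->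
  if theta n then ball1 (B x n) else ball0 (B x n).
Proof.
move=> xr; have up := berk_orbit_upper x n xr; have := rho_lt n.
have [th|th] := boolP (theta n) => lt_n.
  apply: (bdist_lt _ _ _ (F n)); last exact: orbit1.
  by apply: le_lt_trans up _; rewrite -(powRr0 A) ltr_powR_gt1.
have [vF F1 _] := orbit0 n th.
apply: (bdist_lt _ _ _ (F n)); last by rewrite subr0.
by apply: le_lt_trans up _; apply: lt_trans F1; rewrite vF ltr_powR_gt1.
Qed.

Lemma iter_berk_pt z n : B (berk_pt v z) n = berk_pt v (iter n f z).
Proof. exact: iter_berk_map_pt. Qed.

Lemma disk_itinerary z n : v (z - x0) <= r -> v (iter n f z - (theta n)%:R) < 1.
Proof.
rewrite -bdist_berk_pt => /(berk_itinerary _ n); rewrite iter_berk_pt.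
by case: (theta n); rewrite /ball0 /ball1 /= bdist_berk_pt.
Qed.

Lemma disk_filled z : v (z - x0) <= r -> filled_Julia v p a z.
Proof.
move=> zr; exists 1 => n _; have := disk_itinerary z n zr.
by case: (theta n) => [/(un_near1 v) -> //|]; rewrite subr0 => /ltW.
Qed.

Lemma larger_disk_hits1 t' : t < t' -> exists y n, v (y - x0) <= A `^ t' /\ iter n f y = 1.
Proof.
move=> /rho_esc[n rn]; have [|y yt y1] := disk_image_lower n t' 1.
  apply: (@le_trans _ _ 1); last by rewrite -(powRr0 A) ler_powR_gt1.
  have [th|th] := boolP (theta n); first by rewrite un_distC ltW// orbit1.
  by have [_ F1 _] := orbit0 n th; rewrite unB_le ?un1// ltW.
by exists y, n.
Qed.

(** The n-th iterate is not constant, as it fixes 0 and sends y to 1, so a small disk about y covers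
    a disk about 1. The linear coefficient at 1 has norm A, so further iterates cover disks of any
    radius. *)
Lemma backward1_expands y n (eps s : R) : iter n f y = 1 -> 0 < eps ->
  exists N, forall w, v (w - 1) <= s -> exists2 y', v (y' - y) <= eps & iter N f y' = w.
Proof.
move=> y1 eps0; have [Q HQ] := iter_poly p a n.
have [j [j0 cj]] : exists j, (0 < j)%N /\ taylor_coef Q y j != 0.
  apply: contrapT => no; have [k Ek] := horner_taylor_sub Q y.
  have := Ek 0; rewrite big1 => [|i _].
    by rewrite !HQ (iter_Pa0 p p_prime) y1 sub0r => /eqP; rewrite oppr_eq0 oner_eq0.
  have [->|ci] := eqVneq (taylor_coef Q y i.+1) 0; first by rewrite mul0r.
  by case: no; exists i.+1.
pose d := v (taylor_coef Q y j) * eps ^+ j.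
have d0 : 0 < d by rewrite mulr_gt0 ?un_gt0// exprn_gt0.
have [k hk] := exprn_unbounded A va (s / d).
rewrite ltr_pdivrMr// in hk.
have expand i w : v (w - 1) <= A ^+ i * d -> exists2 y', v (y' - 1) <= d & iter i f y' = w.
  elim: i w => [|i IH] w wi; first by exists w; rewrite // -[d]mul1r -(expr0 A).
  have s0 : 0 < A ^+ i * d by rewrite mulr_gt0// exprn_gt0.
  have [|h hi hw] := disk_surj v (Pa p a) 1 w (A ^+ i * d) 1 s0 isT.
    rewrite -/(Pa_map p a 1) Pa_map1 (un_taylor1 v p p_prime vp a va) un1// expr1n mulr1 expr1.
    by rewrite mulrA -exprS.
  by have [y' y'd y'h] := IH h hi; exists y' => //; rewrite iterS y'h.
exists (k + n)%N => w ws.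
have [|y' y'd y'w] := expand k w; first exact: le_trans (ltW hk).
have [|y'' y''e y''y'] := disk_surj v Q y y' eps j eps0 j0; first by rewrite HQ y1.
by exists y'' => //; rewrite iterD -HQ y''y'.
Qed.

Lemma iter_escapes z n : A <= v z -> A ^+ n.+1 <= v (iter n f z).
Proof.
move=> zA; elim: n => [|n IH]; first by rewrite expr1.
have z1 : 1 < v (iter n f z).
  apply: lt_le_trans IH; apply: lt_le_trans va _.
  by rewrite -[leLHS]expr1 ler_weXn2l// ltW.
rewrite iterS (un_Pa_gt1 v p a va)// exprS ler_pM2l//; apply: le_trans IH _.
by rewrite -[leLHS]expr1 ler_weXn2l// ltW.
Qed.

Lemma backward1_not_filled y n (eps : R) : iter n f y = 1 -> 0 < eps ->
  exists2 y', v (y' - y) <= eps & ~ filled_Julia v p a y'.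
Proof.
move=> y1 eps0; have [N HN] := backward1_expands y n eps A y1 eps0.
have [|y' y'y y'a] := HN a; first by rewrite unB_le ?un1// ltW.
exists y' => // -[C HC]; have [k hk] := exprn_unbounded A va C.
have := HC (k.+1 + N)%N isT; rewrite iterD y'a leNgt => /negP; apply.
apply: lt_le_trans (iter_escapes a k.+1 (lexx _)); apply: lt_trans hk _.
by rewrite ltr_eXn2l.
Qed.

Lemma component_ball : Julia_component_ball v p a x0 r.
Proof.
split=> // [z zr|r' rr' sub]; first exact: disk_filled.
have r'0 : 0 < r' by apply: lt_trans rr'.
have [t1 t1E] := powR_gt1_onto A va r' r'0.
have tt1 : t < t1 by rewrite -(ltr_powR_gt1 A va) -t1E.
have tmid : t < (t + t1) / 2 by lra.
have [y [n [yt y1]]] := larger_disk_hits1 _ tmid.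
have lt_r' : A `^ ((t + t1) / 2) < r' by rewrite t1E ltr_powR_gt1//; lra.
have [y' y'y not_y'] := backward1_not_filled y n r y1 r_gt0.
apply: not_y'; apply: sub; rewrite /open_disk /= -(subrKA y).
by rewrite unD_lt// ?(le_lt_trans y'y rr')// (le_lt_trans yt).
Qed.

Lemma ball_wandering : wandering f (closed_disk v x0 r).
Proof.
apply: (itinerary_wandering _ theta _ [set z | v z < 1] [set z | v (z - 1) < 1]) => //.
  apply/seteqP; split=> // z [/= z0 /(un_near1 v) z1].
  by rewrite z1 ltxx in z0.
move=> z n zr; have := disk_itinerary z n zr.
by case: (theta n); rewrite ?subr0.
Qed.

Local Notation bP := (berk_poly (v := v) (Pa p a)).
Local Notation J := (@Fatou_set (berkP1 v) bP).

Definition berk_ball : set (berkA1 v) := [set x | bdist v x x0 < r].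

Lemma berk_ball_Fatou x : berk_ball x -> J (Some x).
Proof.
move=> xr; exists (Some @` berk_ball); split; last first.
- move=> fin; apply: infinite_nat.
  (* The powers of a have norm greater than 1, so they avoid B(0) and B(1), which contain all
     iterates of the ball. *)
  pose g (k : nat) : berkP1 v := Some (berk_pt v (a ^+ k.+1)).
  apply: (@sub_finite_set _ _ (g @^-1` (~` \bigcup_n (iter n bP @` (Some @` berk_ball))))).
    move=> k _ [n _ [_ [y yr <-]]]; rewrite iter_berk_poly => -[yE].
    have := berk_itinerary y n (ltW yr); rewrite yE; set z := a ^+ k.+1.
    have z1 : 1 < v z by rewrite unX exprn_egt1.
    case: (theta n); rewrite /ball0 /ball1 /= bdist_berk_pt ?subr0.
      by move/(un_near1 v) => E; rewrite E ltxx in z1.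
    by rewrite ltNge ltW.
  apply: finite_preimage fin => k k' _ _ /Some_inj/berk_pt_inj/(congr1 v).
  by rewrite !unX => /(ieexprIn A0 (negbT (gt_eqF va)))[].
- by exists x.
- by apply: one_point_compactification_open_some; exact: open_bdist_lt.
Qed.

(* The boundary point of the ball lies in the Julia set: its neighbourhoods
   contain disks meeting the backward orbit of the repelling fixed point 1. *)
Lemma boundary_not_Fatou x : bdist v x x0 = r ->
  (forall w, v (x0 - w) <= r -> bdist v x w = r) -> ~ J (Some x).
Proof.
move=> xr xgen [V [oV Vx]]; apply.
have nV : nbhs x (Some @^-1` V).
  have : nbhs (Some x : berkP1 v) V by apply: open_nbhs_nbhs.
  exact.
have [r' rr' HV] := annulus_nbhs v x x0 r _ xr xgen nV.
have r'0 : 0 < r' by apply: lt_trans rr'.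
have [t1 t1E] := powR_gt1_onto A va r' r'0.
have tt1 : t < t1 by rewrite -(ltr_powR_gt1 A va) -t1E.
have tmid : t < (t + t1) / 2 by lra.
have [y [n [yt y1]]] := larger_disk_hits1 _ tmid.
have lt_r' : A `^ ((t + t1) / 2) < r' by rewrite t1E ltr_powR_gt1//; lra.
(* Orbits from the ball return to B(0) after time n, whereas that of y stays at 1. *)
have yr : r < v (y - x0).
  rewrite ltNge; apply/negP => yr; have [k nk th] := theta_zeros n.
  have := disk_itinerary y k yr; rewrite (negbTE th) subr0.
  by rewrite -(subnK nk) iterD y1 iter_Pa1 un1 ltxx.
have CV x' : bdist v x' y <= r -> V (Some x').
  move=> x'y; apply: HV; rewrite (bdist_eqK v x' x0 y) ?(le_lt_trans x'y)//.
  by rewrite yr (le_lt_trans yt).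
apply: (@sub_finite_set _ _ [set None]); last exact: finite_set1.
case=> [z|//]; case.
pose s := bdist v z 1 + 1.
have [N HN] := backward1_expands y n r s y1 r_gt0.
(* This compact image contains the points of K in a disk around 1 chosen to contain z, hence z
   itself by density. *)
have cl : closed (iter N bf @` [set x' | bdist v x' y <= r]).
  apply: compact_closed; first exact: berk_hausdorff.
  apply: continuous_compact; last exact: compact_bdist_le.
  by apply: continuous_subspaceT => ?; exact: iter_berk_map_continuous.
have [|w ws|x' x'y x'z] := berk_pt_dense v a va z 1 s _ cl.
- by rewrite ltrDl.
- have [y' y'y y'w] := HN w ws; exists (berk_pt v y'); first by rewrite /= bdist_berk_pt.
  by rewrite iter_berk_pt y'w.
exists N => //; exists (Some x'); first exact: CV.
by rewrite iter_berk_poly x'z.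
Qed.

Definition ball_component := @connected_component (berkP1 v) J (Some (berk_pt v x0)).

Lemma open_compl_bdist z (s : R) : @open (berkP1 v) (~` (Some @` [set x | bdist v x z <= s])).
Proof.
rewrite openE => -[y|] ny.
  suff : nbhs y [set x | s < bdist v x z].
    rewrite /interior; apply: filterS => y' /= lt_y' [y'' le_y'' [E]].
    by move: lt_y'; rewrite -E ltNge => /negP; apply.
  apply: open_nbhs_nbhs; split; first exact: open_bdist_gt.
  by rewrite /= ltNge; apply/negP => le_y; apply: ny; exists y.
exists [set x | bdist v x z <= s].
  by split; [exact: compact_bdist_le | exact: closed_bdist_le].
move=> y [[y' ny' <-]|-> [y' _]//] [y'' le_y'' [E]]; apply: ny'; by rewrite -E.
Qed.

Lemma component_sub : ball_component `<=` Some @` berk_ball.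
Proof.
pose U : set (berkP1 v) := Some @` berk_ball; rewrite -/U.
have x0F : J (Some (berk_pt v x0)) by apply: berk_ball_Fatou; rewrite /berk_ball /= bdist_berk_pt subrr un0.
have x0W : ball_component (Some (berk_pt v x0)) by apply: connected_component_refl.
have oU : @open (berkP1 v) U by apply: one_point_compactification_open_some; exact: open_bdist_lt.
suff <- : ball_component `&` U = ball_component by move=> y [].
apply: component_connected.
- by exists (Some (berk_pt v x0)); split=> //; exists (berk_pt v x0) => //; rewrite /berk_ball /= bdist_berk_pt subrr un0.
- by exists U.
exists (closure U); first exact: closed_closure.
apply/seteqP; split=> y [Wy Uy]; split=> //; first exact: subset_closure.
have Fy : J y by apply: connected_component_sub Wy.
case: y Wy Uy Fy => [x|] Wx clx Fx; last first.
  have [|y [[x xr <-] ny]] := clx (~` (Some @` [set x | bdist v x x0 <= r])).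
    by apply: open_nbhs_nbhs; split; [exact: open_compl_bdist | case].
  by case: ny; exists x => //; exact: ltW.
have avoid (V : set (berkA1 v)) : open V -> V x -> exists2 y, V y & berk_ball y.
  move=> oV Vx; have [|y [[y1 y1r <-] [y2 Vy2 [E]]]] := clx (Some @` V).
    by apply: open_nbhs_nbhs; split; [exact: one_point_compactification_open_some | exists x].
  by exists y1 => //; rewrite -E.
exists x => //; rewrite /berk_ball /= ltNge; apply/negP => rx.
have xr : bdist v x x0 = r.
  apply/le_anti; rewrite rx andbT leNgt; apply/negP => lt_x.
  have [y /= ry yr] := avoid _ (open_bdist_gt v x0 r) lt_x.
  by move: (lt_trans ry yr); rewrite ltxx.
(* A boundary point of the ball is its Gauss point: if it were at distance less than r from some w
   in the closed disk, w would be in the open disk, and so would x. *)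
apply: (boundary_not_Fatou x xr _ Fx) => w xw.
have le_w : bdist v x w <= r by apply: (bdist_le v x w x0); rewrite ?xr.
apply/le_anti; rewrite le_w /= leNgt; apply/negP => lt_w.
have [y /= yw yr] := avoid _ (open_bdist_lt v w r) lt_w.
have : v (w - x0) < r.
  apply: le_lt_trans (un_le_bdist v y w x0 (Num.max (bdist v y w) (bdist v y x0)) _ _) _.
  - by rewrite le_max lexx.
  - by rewrite le_max lexx orbT.
  by rewrite gt_max yw.
by move=> wx0; have := bdist_lt v x x0 w r lt_w wx0; rewrite xr ltxx.
Qed.

(** The Gauss points of growing disks around x0 and around z form two paths in the Fatou set that
    meet at radius |z - x0|. *)
Lemma disk_sub_component z : v (z - x0) < r -> ball_component (Some (berk_pt v z)).
Proof.
move=> zr; set d := v (z - x0) in zr.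
have d0 : 0 <= d by exact: ultranorm_ge0.
pose path w := (fun s : R => Some (disk_point v a va w s) : berkP1 v) @` `[0, d]%classic.
have conn w : connected (path w).
  apply: connected_continuous_connected; first exact: segment_connected.
  apply: continuous_subspaceT => s.
  apply: (@continuous_comp _ _ _ (disk_point v a va w) (Some : berkA1 v -> berkP1 v)).
    exact: disk_point_continuous.
  exact: one_point_compactification_some_continuous.
have end0 w : path w (Some (berk_pt v w)).
  by exists 0; [rewrite /= in_itv /= lexx d0 | rewrite disk_point0].
have sub w : v (w - x0) <= d -> path w `<=` J.
  move=> wd _ [s + <-]; rewrite /= in_itv /= => /andP[s0 sd]; apply: berk_ball_Fatou.
  rewrite /berk_ball /= bdist_disk_point ger0_norm// gt_max !(le_lt_trans _ zr)//.
apply: (@connected_component_max _ _ (path x0 `|` path z)); last by right.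
- by left.
- by move=> y [|]; apply: sub => //; rewrite subrr un0.
apply: connectedU => //; exists (Some (disk_point v a va x0 d)); split.
  by exists d => //; rewrite /= in_itv /= d0 lexx.
exists d; first by rewrite /= in_itv /= d0 lexx.
by rewrite (disk_point_eq v a va z x0)// ger0_norm.
Qed.

Lemma component_trace : open_disk v x0 r = @berk_of R K v @^-1` ball_component.
Proof.
apply/seteqP; split=> z /=; first exact: disk_sub_component.
move=> /component_sub[x xr [E]]; rewrite /open_disk /= -bdist_berk_pt.
by have <- : x = berk_pt v z by exact: E.
Qed.

Lemma component_wandering : wandering bP ball_component.
Proof.
apply: (itinerary_wandering _ theta _ (Some @` ball0) (Some @` ball1)) => //.
  apply/seteqP; split=> // _ [[x x0' <-] [y y1 [E]]].
  have : (ball0 `&` ball1) x by split; rewrite // -E.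
  by rewrite ball01.
move=> _ n /component_sub[x xr <-]; rewrite iter_berk_poly.
have := berk_itinerary x n (ltW xr).
by case: (theta n) => h; exists (B x n).
Qed.

Lemma bdist_eq0 x z : bdist v x z = 0 -> x = berk_pt v z.
Proof.
move=> xz; apply: bdist_ext => w; rewrite bdist_berk_pt.
have [->|wz] := eqVneq w z; first by rewrite xz subrr un0.
by apply: bdist_eqK; rewrite xz un_gt0 subr_eq0 eq_sym.
Qed.

(* The orbit accumulates at the fixed point 1, so a periodic orbit to which it
   is asymptotic is reduced to 1, but the orbit visits B(0) infinitely often. *)
Lemma component_not_asymptotic b : ball_component b -> ~ @asymptotic_to_periodic (berkP1 v) bP b.
Proof.
move=> /component_sub[x xr <-] [y [k [k0 yk asy]]].
have per j : iter (j * k) bP y = y.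
  by elim: j => // j IH; rewrite mulSn iterD IH.
have perD j n : iter (n + j * k) bP y = iter n bP y by rewrite iterD per.
have fix1 n : iter n bP (Some (berk_pt v 1)) = Some (berk_pt v 1).
  by rewrite iter_berk_poly iter_berk_pt iter_Pa1.
have [[i yi]|no1] := pselect (exists i, iter i bP y = Some (berk_pt v 1)).
  have orb j : iter j bP y = Some (berk_pt v 1).
    have ij : (i <= j + i * k)%N by apply: leq_trans (leq_addl _ _); rewrite leq_pmulr.
    by rewrite -(perD i j) -(subnK ij) iterD yi fix1.
  have [||N _ HN] := asy (Some @` ball1).
  - by apply: one_point_compactification_open_some; exact: open_bdist_lt.
  - by move=> _ [j _ <-]; rewrite orb; exists (berk_pt v 1) => //; rewrite /ball1 /= bdist_berk_pt subrr un0.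
  have [n Nn th] := theta_zeros N.
  have [x' x'1] := HN n Nn; rewrite iter_berk_poly => -[E].
  have := berk_itinerary x n (ltW xr); rewrite (negbTE th) => b0.
  have : (ball0 `&` ball1) (B x n) by split; rewrite // -E.
  by rewrite ball01.
(* A finite orbit missing 1 avoids a closed disk around 1, so the complement of this disk is a
   neighbourhood of the periodic orbit. *)
have [eps eps0 Heps] : exists2 eps : R, 0 < eps & forall j, (j < k)%N -> forall c,
    iter j bP y = Some c -> eps < bdist v c 1.
  elim: (k) => [|j [eps eps0 IH]]; first by exists 1.
  case jE: (iter j bP y) => [z|].
    have z1 : 0 < bdist v z 1.
      rewrite lt_def bdist_ge0 andbT; apply/eqP => z1; apply: no1.
      by exists j; rewrite jE (bdist_eq0 z 1 z1).
    have [m m0 [me mz]] : exists2 m : R, 0 < m & m <= eps /\ m < bdist v z 1.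
      exists (Num.min eps (bdist v z 1 / 2)); first by rewrite lt_min eps0 divr_gt0.
      split; first by rewrite ge_min lexx.
      by rewrite gt_min; apply/orP; right; lra.
    exists m => // i; rewrite ltnS leq_eqVlt => /predU1P[->|ij] z' E.
      by move: E; rewrite jE => -[<-].
    exact: le_lt_trans me (IH i ij z' E).
  exists eps => // i; rewrite ltnS leq_eqVlt => /predU1P[-> z E|]; last exact: IH.
  by rewrite jE in E.
have [||N _ HN] := asy (~` (Some @` [set x | bdist v x 1 <= eps])).
- exact: open_compl_bdist.
- move=> _ [j _ <-] [z z1 E].
  have jk : iter (j %% k) bP y = Some z.
    by rewrite E [in RHS](divn_eq j k) addnC perD.
  by have := Heps _ (ltn_pmod j k0) z jk; rewrite ltNge => /negP; apply.
have [n Nn [F1 rn]] := orbit_near1 eps N eps0.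
apply: (HN n Nn); rewrite iter_berk_poly; exists (B x n) => //=.
apply: (bdist_le v _ 1 (F n)) => //.
by apply: le_trans rn; exact: berk_orbit_upper (ltW xr).
Qed.

Lemma wandering_ball : nontrivial_wandering_ball v p a x0 r.
Proof.
split; [exact: component_ball | exact: ball_wandering | exists ball_component].
split; last exact: component_trace.
split; [|exact: component_wandering|exact: component_not_asymptotic].
exists (Some (berk_pt v x0)) => //.
by apply: berk_ball_Fatou; rewrite /berk_ball /= bdist_berk_pt subrr un0.
Qed.

End Wandering_ball.

(** * Assembly of the orbit, the radii and the Fatou component *)

Theorem mainTheorem3 (R : realType) (K : closedFieldType) (v : ultranorm R K)
  (p : nat) (v_nontrivial : nontrivial_norm v) (v_complete : complete_norm v)
  (v_residue : residue_char v p)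
  (l : nat -> nat) (l0 : l 0%N = 0%N) (l_incr : forall i, (l i < l i.+1)%N)
  (s : nat -> nat)
  (s_spec : forall k : nat,
     ((l (s k))%:Z * (p%:Z - 1) ^+ 2 - 1 <= k%:Z) /\
     (k%:Z < (l (s k).+1)%:Z * (p%:Z - 1) ^+ 2 - 1)) :
  forall a0 : K, param_set v p a0 ->
    exists a x0 : K,
      [/\ param_set v p a,
          v (a - a0) = v a0 ^- (M_seq p l s 0 - 1),
          filled_Julia v p a x0,
          is_itinerary v p a x0 (block_word (m_seq p l s) (M_seq p l s)) &
          nontrivial_wandering_ball v p a x0 (v a `^ t_exp R p l)].
Proof.
move=> a0 a0P; have [p_prime vp] := v_residue; have p2 := prime_gt1 p_prime.
set m := m_seq p l s; set M := M_seq p l s.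
have mge2 : forall k, (1 < m k)%N := m_ge2 p l s p2.
have mgt0 k : (0 < m k)%N := ltnW (mge2 k).
have Mincr : forall k, (M k + 2 <= M k.+1)%N := M_seq_incr p l s p2 l0 l_incr s_spec.
have M0 : (1 < M 0)%N by rewrite /M M_seqE muln1 (leq_trans _ (leq_addr _ _)).
have [a [x [va aa0 orb]]] := wandering_orbit_exists v p p_prime vp v_complete m M mgt0 M0
  Mincr (block_contracts R p l s p2) a0 a0P.
have aP : param_set v p a.
  by case: a0P => a1 ap; split; rewrite ?va// ultranormM va -ultranormM.
have a1 : 1 < v a by case: aP.
have Mge k : (k <= M k)%N.
  by elim: k => // k IH; apply: leq_trans (Mincr k); rewrite addn2 ltnS leqW.
set theta := block_word m M; set T := block_start m M; set F := fun n => iter n (Pa_map p a) x.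
(* The exponents are read off the orbit, as logarithms in base |a|; on the zeros they are the
   prescribed values of [zeta]. *)
pose e n : R := - (ln (v (F n)) / ln (v a)).
have zgt0 k i : (i < m k)%N -> 0 < zeta p (m k - i) :> R.
  by move=> im; rewrite -(prednK (_ : 0 < m k - i)%N) ?zetaS_gt0// subn_gt0.
have eE k i : (i < m k)%N -> e (T k + i)%N = zeta p (m k - i).
  move=> im; have [/(_ i im) vF _] := orb k.
  by rewrite /e /F vF ln_powR mulfK ?opprK// gt_eqF// ln_gt0.
have o0 n : ~~ theta n ->
    [/\ v (F n) = v a `^ (- e n), v (F n) < 1 & v p%:R < v (F n)].
  have [k [i [-> ik]]] := block_decomp m M mgt0 n.
  rewrite /theta block_wordE// -ltnNge => im; have [/(_ i im) vF _] := orb k.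
  rewrite eE// /F vF; split=> //.
    by rewrite -(powRr0 (v a)) ltr_powR_gt1// oppr_lt0 zgt0.
  exact: (vp_lt_sphere v p (v a) p_prime a1 (param_setE v p a aP)).
have o1 n : theta n -> v (F n - 1) < 1.
  have [k [i [-> ik]]] := block_decomp m M mgt0 n.
  rewrite /theta block_wordE// => mi; have iM : (i - m k < M k)%N by rewrite ltn_subLR.
  have [_ /(_ _ iM)] := orb k; rewrite -addnA subnKC// => vF.
  by rewrite /F vF -[ltRHS](powRr0 (v a)) ltr_powR_gt1// subr_lt0 ltr_nat.
set t := t_exp R p l.
have start_lt := rho_start_lt R p l s p2 l0 l_incr s_spec e eE.
have rl n : rho p theta e t n < if theta n then 0 else - e n.
  have [k [i [-> ik]]] := block_decomp m M mgt0 n.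
  have [h0 h1] := rho_zero_bounds p p2 m M e mge2 eE t start_lt k.
  rewrite /theta block_wordE//; case: leqP => mi; last by rewrite eE// h0.
  have iM : (i - m k < M k)%N by rewrite ltn_subLR.
  by have := h1 _ iM; rewrite -addnA subnKC.
have esc := rho_larger_escapes R p l s p2 l0 l_incr s_spec e eE.
have aper := block_word_aperiodic m M mgt0 Mge.
have zeros N : exists2 n, (N <= n)%N & ~~ theta n.
  exists (T N + 0)%N; first by rewrite addn0 block_start_ge.
  by rewrite /theta block_wordE ?addn_gt0 ?mgt0// -ltnNge.
have near1 (eps : R) N : 0 < eps ->
    exists2 n, (N <= n)%N & v (F n - 1) <= eps /\ v a `^ rho p theta e t n <= eps.
  move=> eps0; have [j hj] := exprn_unbounded (v a) a1 eps^-1.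
  pose k := (N + j)%N; have Mk : v a `^ (- (M k)%:R) <= eps.
    rewrite powRN -[leRHS]invrK lef_pV2 ?posrE ?invr_gt0 ?powR_gt0 ?(lt_trans ltr01 a1)//.
    apply: le_trans (ltW hj) _; rewrite powR_mulrn ?ultranorm_ge0//.
    by rewrite ler_weXn2l ?(ltW a1)// (leq_trans _ (Mge k))// leq_addl.
  (* At the start of block k of ones the orbit is at distance A^(-M_k) from 1, and the radius
     exponent is below - M_k because it is still negative after growing by M_k. *)
  exists (T k + m k + 0)%N.
    rewrite addn0 (leq_trans _ (leq_addr _ _))// (leq_trans _ (block_start_ge m M mgt0 k))//.
    exact: leq_addr.
  have Mk0 : (0 < M k)%N.
    by case: (k) => [|k']; [exact: ltnW | apply: leq_trans (Mincr k'); rewrite addn2].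
  have [_ /(_ _ Mk0)] := orb k; rewrite sub0r => vF; split; first by rewrite /F vF.
  apply: le_trans Mk; rewrite ler_powR_gt1// addn0.
  have := start_lt k.+1; rewrite block_startS (rho_one p m M e mge2 _ _ _ (leqnn _)).
  have := @zeta_ge0 R p (m k.+1); rewrite -/t -/theta -/T; lra.
have r0 : v (x - x) <= v a `^ t by rewrite subrr un0 powR_ge0.
exists a, x; split=> //.
- exact: (disk_filled v p a x theta e t).
- by move=> n; apply: (disk_itinerary v p a x theta e t).
- exact: (wandering_ball v p a x theta e t).
Qed.
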